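(* Let $\mathcal{K}\subseteq\mathbb{R}^{m,n}$ be a compact convex set and assume that there is some $D>0$ such that $\|x\|_1\le D$ (nuclear norm) holds for all $x\in\mathcal{K}$. Let $\{x_t\}$ be the sequence generated by the update rule (adaptive optimistic online mirror descent) $$x_{t+1}=\arg\min_{x\in\mathcal{K}}\ \langle g_t-h_t+h_{t+1},x\rangle+r_{t+1}(x)+\mathcal{B}_{\Phi_{t+1}}(x,x_t)$$ for the sequence of subgradients $g_t\in\partial l_t(x_t)$ and a sequence of hints $\{h_t\}$, with the regulariser $\Phi_t=\phi_t\circ\sigma:\mathbb{R}^{m,n}\to\mathbb{R}$, where $\sigma(x)\in\mathbb{R}^{\min\{m,n\}}$ is the vector of singular values of $x$ and $$\phi_t(v)=\alpha_t\sum_{i=1}^{\min\{m,n\}}\Big((|v_i|+\beta)\ln\Big(\frac{|v_i|}{\beta}+1\Big)-|v_i|\Big),\quad v\in\mathbb{R}^{\min\{m,n\}}.$$ Setting $$\beta=\frac{1}{\min\{m,n\}},\qquad \eta=\sqrt{\frac{1}{\ln(D+1)+\ln\min\{m,n\}}},\qquad \alpha_t=\eta\sqrt{\sum_{s=1}^{t-1}\|g_s-h_s\|_\infty^2},$$ we obtain $$\mathcal{R}_{1:T}\le r_1(x_1)+c(m,n,D)\sqrt{\sum_{t=1}^T\|g_t-h_t\|_\infty^2}$$ with $c(m,n,D)\in\mathcal{O}\big(D\sqrt{\ln(D+1)+\ln\min\{m,n\}}\big)$.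
   Context: Online composite convex optimisation over $T$ rounds with matrix decisions: in round $t$ the player chooses $x_t\in\mathcal{K}$, then a convex function $l_t:\mathcal{K}\to\mathbb{R}$ is revealed and the player suffers $f_t(x_t)$, where $f_t=l_t+r_t$ and $r_t:\mathbb{R}^{m,n}\to\mathbb{R}_{\ge0}$ is a known closed convex function. The regret is $\mathcal{R}_{1:T}=\sum_{t=1}^T f_t(x_t)-\min_{x\in\mathcal{K}}\sum_{t=1}^T f_t(x)$. $\langle\cdot,\cdot\rangle$ is the Frobenius inner product; for matrices $\|\cdot\|_1$ is the nuclear norm and $\|\cdot\|_\infty$ the spectral norm. The subgradient set is $\partial l_t(y)=\{g\in\mathbb{R}^{m,n} : l_t(x)-l_t(y)\ge\langle g,x-y\rangle\ \forall x\in\mathcal{K}\}$. The hints $h_t$ are matrices in $\mathbb{R}^{m,n}$. $\mathcal{B}_\Phi(x,y)=\Phi(x)-\Phi(y)-\langle\nabla\Phi(y),x-y\rangle$ is the Bregman divergence. The quantity $c(m,n,D)$ depends only on $m,n,D$.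
   Formalization: The start is specified: x_1 in K with either h_1 = 0 or x_1 minimising <h_1,x> + r_1(x) over K (for arbitrary x_1 and h_1 the bound is false); the O-bound on c is uniform in m, n and in D bounded away from 0, since it fails as D tends to 0. *)

(* Defs.v *)
From HB Require Import structures.
From mathcomp Require Export all_boot all_order all_algebra.
From mathcomp Require Export all_classical all_reals all_analysis.
Export Order.TTheory GRing.Theory Num.Theory.
Export numFieldNormedType.Exports.

Set Implicit Arguments.
Unset Strict Implicit.
Unset Printing Implicit Defensive.

Local Open Scope classical_set_scope.
Local Open Scope ring_scope.

Definition frob_inner (R : realType) (m n : nat) (x y : 'M[R]_(m, n)) : R :=
  \sum_(i < m) \sum_(j < n) x i j * y i j.

(* Thin singular value decomposition x = U diag(s) V^T, where U and V have
   min(m,n) orthonormal columns and s is nonnegative and nonincreasing. *)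
Definition is_singular_values (R : realType) (m n : nat) (x : 'M[R]_(m, n))
    (s : 'rV[R]_(minn m n)) : Prop :=
  [/\ forall i, 0 <= s 0 i,
      forall i j : 'I_(minn m n), (i <= j)%N -> s 0 j <= s 0 i &
      exists (U : 'M[R]_(m, minn m n)) (V : 'M[R]_(n, minn m n)),
        [/\ U^T *m U = 1%:M, V^T *m V = 1%:M & x = U *m diag_mx s *m V^T]].

(* Every real matrix has exactly one vector s as above, so the default value
   of xget is never used. *)
Definition singular_values (R : realType) (m n : nat) (x : 'M[R]_(m, n)) :
    'rV[R]_(minn m n) :=
  xget 0 [set s | is_singular_values x s].

Definition nuclear_norm (R : realType) (m n : nat) (x : 'M[R]_(m, n)) : R :=
  \sum_(i < minn m n) singular_values x 0 i.

Definition spectral_norm (R : realType) (m n : nat) (x : 'M[R]_(m, n)) : R :=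
  \big[Num.max/0]_(i < minn m n) singular_values x 0 i.

(* Gradient for the Frobenius inner product: the matrix of the partial
   derivatives. *)
Definition gradient (R : realType) (m n : nat) (F : 'M[R]_(m, n) -> R)
    (y : 'M[R]_(m, n)) : 'M[R]_(m, n) :=
  \matrix_(i, j) 'D_(delta_mx i j) F y.

Definition bregman (R : realType) (m n : nat) (F : 'M[R]_(m, n) -> R)
    (x y : 'M[R]_(m, n)) : R :=
  F x - F y - frob_inner (gradient F y) (x - y).

Definition subgradients (R : realType) (m n : nat) (K : set 'M[R]_(m, n))
    (l : 'M[R]_(m, n) -> R) (y : 'M[R]_(m, n)) : set 'M[R]_(m, n) :=
  [set g | forall x, K x -> frob_inner g (x - y) <= l x - l y].

Definition closed_function (R : realType) (m n : nat)
    (r : 'M[R]_(m, n) -> R) : Prop :=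
  closed [set p : 'M[R]_(m, n) * R | r p.1 <= p.2].

Definition argmins (R : realType) (V : Type) (K : set V) (F : V -> R) : set V :=
  [set x | K x /\ forall y, K y -> F x <= F y].

(* Rounds are numbered from 1. The best fixed decision in hindsight enters
   through the infimum, which is the minimum whenever the latter exists. *)
Definition regret (R : realType) (m n : nat) (K : set 'M[R]_(m, n))
    (f : nat -> 'M[R]_(m, n) -> R) (x : nat -> 'M[R]_(m, n)) (T : nat) : R :=
  \sum_(1 <= t < T.+1) f t (x t)
  - inf [set \sum_(1 <= t < T.+1) f t u | u in K].

Definition phi (R : realType) (d : nat) (alpha beta : R) (v : 'rV[R]_d) : R :=
  alpha * \sum_(i < d)
    ((`|v 0 i| + beta) * ln (`|v 0 i| / beta + 1) - `|v 0 i|).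

Definition Phi (R : realType) (m n : nat) (alpha beta : R)
    (x : 'M[R]_(m, n)) : R :=
  phi alpha beta (singular_values x).

Definition log_factor (R : realType) (m n : nat) (D : R) : R :=
  ln (D + 1) + ln (minn m n)%:R.

Definition eta (R : realType) (m n : nat) (D : R) : R :=
  Num.sqrt (1 / log_factor m n D).

Definition alpha (R : realType) (m n : nat) (D : R)
    (g h : nat -> 'M[R]_(m, n)) (t : nat) : R :=
  eta m n D * Num.sqrt (\sum_(1 <= s < t) spectral_norm (g s - h s) ^+ 2).

Definition beta (R : realType) (m n : nat) : R := 1 / (minn m n)%:R.

Definition regulariser (R : realType) (m n : nat) (D : R)
    (g h : nat -> 'M[R]_(m, n)) (t : nat) : 'M[R]_(m, n) -> R :=
  Phi (alpha D g h t) (beta R m n).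

(* c(m,n,D) is O(D sqrt(ln(D+1) + ln min(m,n))), uniformly in m, n >= 1 and in
   D bounded away from 0.  As D -> 0 with min(m,n) = 1 the reference function
   is of order D^(3/2), whereas any regret constant is at least 2 D: the
   constant of the O cannot be uniform down to D = 0. *)
Definition constant_bigO (R : realType) (c : nat -> nat -> R -> R) : Prop :=
  forall D0 : R, 0 < D0 ->
  exists C : R, forall (m n : nat) (D : R),
    (0 < m)%N -> (0 < n)%N -> D0 <= D ->
    `|c m n D| <= C * (D * Num.sqrt (log_factor m n D)).

(* Main.v *)
Require Import Defs.
From mathcomp Require Import ring lra.

(** Against a fixed comparator [u], optimistic mirror descent pays in each round
    the stability term [<g_t - h_t, x_t - x_(t+1)> - B_(t+1)(x_(t+1), x_t)] plus
    the change of the divergence to [u], while the hints telescope.  With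
    [S_t] the root of the sum of the first [t] squared gradient errors and
    [alpha_(t+1) = eta * S_t], the change of the divergence costs at most
    [alpha_T] times the diameter of the decision set in divergence, and the
    stability terms are of order [|g_t - h_t|^2 / alpha_(t+1)], which is at most
    a multiple of [S_t - S_(t-1)].  Everything adds up to a multiple of [S_T]
    ([regret_prefix]).

    Three facts about [Phi] are needed: it is differentiable with the spectral
    gradient [U f'(s) V^T] ([gradient_Phi]), its divergence is of second order
    along segments, which yields the optimality condition of the update
    ([mirror_step]), and its divergence controls the nuclear norm: for [W] of
    spectral norm [c],
      [<W, x - y> <= B(x, y) + c^2 * O(D + 1) / alpha]  ([pairing_le_bregman]),
    which is strong convexity for the nuclear norm in dual form.

    All three come from one identity, [svd_bregman_decomp].  If
    [X = P diag(s) Q^T] and [Y = U diag(t) V^T], the divergence between [X] and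
    [Y] of the spectral function built on an even scalar [f] is a combination,
    with nonnegative weights read off [U^T P] and [V^T Q], of the scalar
    divergences of [s_j], [- s_j] or 0 from [t_i] or 0.  Scalar inequalities thus
    pass to matrices term by term.  As [f v = (|v| + b) ln (|v| / b + 1) - |v|]
    has second derivative [1 / (|v| + b)], its divergence lies between
    [(x - y)^2 / (2 (|x| + |y| + 2 b))] and [(x - y)^2 / b].  The upper bound
    compares [f] with the square, whose spectral function is the squared
    Frobenius norm: this is the differentiability and the second-order
    estimate.  The lower bound, combined with an arithmetic-geometric mean in
    each coordinate of [<W, X - Y>], is [pairing_le_svd_bregman]; the
    denominators sum to the nuclear norms plus [b] times the dimension, that
    is to at most a multiple of [D + 1], because [b] is the inverse of the
    dimension.

    Finally [alpha_T * L] and [S_T / eta] both equal [sqrt L * S] up to the index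
    of [S], where [L = ln (D + 1) + ln (min m n)] bounds the spectral norm of
    the gradient of the unscaled [Phi] on the decision set: this is the choice
    of [eta]. *)

Set Implicit Arguments.
Unset Strict Implicit.
Unset Printing Implicit Defensive.

Local Open Scope classical_set_scope.
Local Open Scope ring_scope.

(** * The scalar potential *)

Definition ent (R : realType) (b v : R) : R :=
  (`|v| + b) * ln (`|v| / b + 1) - `|v|.

Definition ent_deriv (R : realType) (b v : R) : R :=
  Num.sg v * ln (`|v| / b + 1).

Definition scalar_bregman (R : realType) (f f' : R -> R) (x y : R) : R :=
  f x - f y - f' y * (x - y).

Lemma ln_ge_oneBinv (R : realType) (t : R) : 0 < t -> 1 - t^-1 <= ln t.
Proof.
move=> t0; have := @le_ln1Dx R (t^-1 - 1).
have -> : 1 + (t^-1 - 1) = t^-1 :> R by ring.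
rewrite lnV ?posrE// => H.
have ti : 0 < t^-1 by rewrite invr_gt0.
have : - 1 < t^-1 - 1 by lra.
by move/H; lra.
Qed.

Lemma ln_le_subr1 (R : realType) (t : R) : 0 < t -> ln t <= t - 1.
Proof. by move=> t0; rewrite -[t in ln t](subrKC 1) le_ln1Dx//; lra. Qed.

(** Halving the logarithm, that is [ln (X / Y) = 2 * ln (sqrt X / sqrt Y)],
    turns the first-order bound [1 - 1 / t <= ln t] into a quadratic one. *)
Lemma relative_entropy_ge (R : realType) (X Y : R) : 0 < X -> 0 < Y ->
  (X - Y) ^+ 2 / (2 * (X + Y)) <= X * ln (X / Y) - X + Y.
Proof.
move=> X0 Y0.
pose a := Num.sqrt X; pose c := Num.sqrt Y.
have a0 : 0 < a by rewrite sqrtr_gt0.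
have c0 : 0 < c by rewrite sqrtr_gt0.
have -> : X = a ^+ 2 by rewrite sqr_sqrtr// ltW.
have -> : Y = c ^+ 2 by rewrite sqr_sqrtr// ltW.
rewrite -expr_div_n lnXn ?divr_gt0// mulr2n.
have := @ln_ge_oneBinv R (a / c); rewrite divr_gt0// => /(_ isT).
rewrite invf_div; set L := ln _ => hL.
have h1 : a ^+ 2 * (1 - c / a) <= a ^+ 2 * L by rewrite ler_pM2l ?exprn_gt0.
have e1 : a ^+ 2 * (1 - c / a) = a ^+ 2 - a * c by field; rewrite gt_eqF.
rewrite e1 in h1.
apply: (@le_trans _ _ ((a - c) ^+ 2)); last by nra.
rewrite ler_pdivrMr; last by nra.
have -> : (a ^+ 2 - c ^+ 2) ^+ 2 = (a - c) ^+ 2 * (a + c) ^+ 2 by ring.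
rewrite ler_wpM2l ?sqr_ge0//.
by have := sqr_ge0 (a - c); nra.
Qed.

(** The first-order bound [ln t <= t - 1]. *)
Lemma relative_entropy_le (R : realType) (X Y : R) : 0 < X -> 0 < Y ->
  X * ln (X / Y) - X + Y <= (X - Y) ^+ 2 / Y.
Proof.
move=> X0 Y0.
have h : X * ln (X / Y) <= X * (X / Y - 1).
  by rewrite ler_pM2l// ln_le_subr1// divr_gt0.
apply: (@le_trans _ _ (X * (X / Y - 1) - X + Y)); first by lra.
have Y1 : Y != 0 by rewrite gt_eqF.
by rewrite le_eqVlt; apply/orP; left; apply/eqP; field.
Qed.

Lemma entN (R : realType) (b v : R) : ent b (- v) = ent b v.
Proof. by rewrite /ent normrN. Qed.

Lemma ent0 (R : realType) (b : R) : ent b 0 = 0.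
Proof. by rewrite /ent normr0 mul0r !add0r ln1 mulr0 subr0. Qed.

Lemma ent_deriv0 (R : realType) (b : R) : ent_deriv b 0 = 0.
Proof. by rewrite /ent_deriv sgr0 mul0r. Qed.

Lemma ent_deriv_nonneg (R : realType) (b v : R) : 0 <= v ->
  ent_deriv b v = ln (v / b + 1).
Proof.
rewrite le_eqVlt => /orP[/eqP <-|v0].
  by rewrite ent_deriv0 mul0r add0r ln1.
by rewrite /ent_deriv gtr0_sg// gtr0_norm// mul1r.
Qed.

(** On nonnegative arguments the divergence is the relative entropy of the
    arguments shifted by [b]. *)
Lemma bregman_ent_nonneg (R : realType) (b x y : R) : 0 < b -> 0 <= x -> 0 <= y ->
  scalar_bregman (ent b) (ent_deriv b) x y
    = (x + b) * ln ((x + b) / (y + b)) - (x + b) + (y + b).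
Proof.
move=> b0 x0 y0; rewrite /scalar_bregman ent_deriv_nonneg// /ent !ger0_norm//.
have bn : b != 0 by rewrite gt_eqF.
have E : forall z : R, z / b + 1 = (z + b) / b by move=> z; field.
have yb : 0 < y + b by lra.
have xb : 0 < x + b by lra.
rewrite !E !ln_div ?posrE//; ring.
Qed.

Lemma bregman_ent_opp (R : realType) (b x y : R) : 0 < b -> 0 <= x -> 0 <= y ->
  scalar_bregman (ent b) (ent_deriv b) (- x) y
  = scalar_bregman (ent b) (ent_deriv b) x 0
    + scalar_bregman (ent b) (ent_deriv b) 0 y + x * ln (y / b + 1).
Proof.
move=> b0 x0 y0.
rewrite /scalar_bregman entN ent0 ent_deriv0 (ent_deriv_nonneg b y0); ring.
Qed.

(** The second derivative of [ent b] is [1 / (|v| + b)]; this is the resulting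
    local strong convexity.  For arguments of opposite signs the segment is
    cut at 0 and the cross term [x * ln (y / b + 1)] supplies the double
    product of [(x + y) ^+ 2]. *)
Lemma bregman_ent_ge (R : realType) (b x y : R) : 0 < b -> 0 <= y ->
  (x - y) ^+ 2 / (2 * (`|x| + y + 2 * b))
    <= scalar_bregman (ent b) (ent_deriv b) x y.
Proof.
move=> b0 y0; have P u v : 0 <= u -> 0 <= v ->
    (u - v) ^+ 2 / (2 * (u + v + 2 * b))
      <= scalar_bregman (ent b) (ent_deriv b) u v.
  move=> u0 v0; rewrite bregman_ent_nonneg//.
  have := @relative_entropy_ge R (u + b) (v + b).
  have -> : u + b - (v + b) = u - v by ring.
  have -> : u + b + (v + b) = u + v + 2 * b by ring.
  by apply; lra.
have [x0|x0] := leP 0 x; first by rewrite ger0_norm//; exact: P.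
have [u u0 ->] : exists2 u, 0 <= u & x = - u.
  by exists (- x); rewrite ?opprK//; lra.
rewrite normrN ger0_norm// bregman_ent_opp//.
have h1 := P u 0 u0 (lexx 0); have h2 := P 0 y (lexx 0) y0.
have yb : 0 < y / b + 1.
  by apply: ltr_wpDl => //; rewrite divr_ge0// ltW.
have h3 := @ln_ge_oneBinv _ _ yb.
set q := u + y + 2 * b.
have q0 : 0 < q by rewrite /q; lra.
have k1 : u ^+ 2 / (2 * q) <= (u - 0) ^+ 2 / (2 * (u + 0 + 2 * b)).
  rewrite subr0 ler_wpM2l ?sqr_ge0// lef_pV2 ?posrE /q; lra.
have k2 : y ^+ 2 / (2 * q) <= (0 - y) ^+ 2 / (2 * (0 + y + 2 * b)).
  rewrite sub0r sqrrN ler_wpM2l ?sqr_ge0// lef_pV2 ?posrE /q; lra.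
have k3 : 2 * u * y / (2 * q) <= u * ln (y / b + 1).
  apply: le_trans (ler_wpM2l u0 h3).
  have -> : u * (1 - (y / b + 1)^-1) = u * y / (y + b).
    field; apply/andP; split; rewrite gt_eqF//; lra.
  have -> : 2 * u * y / (2 * q) = u * y / q by field; rewrite gt_eqF.
  rewrite ler_wpM2l ?mulr_ge0// lef_pV2 ?posrE /q; lra.
have -> : (- u - y) ^+ 2 / (2 * q)
  = u ^+ 2 / (2 * q) + y ^+ 2 / (2 * q) + 2 * u * y / (2 * q) by field; rewrite gt_eqF.
by lra.
Qed.

Lemma bregman_ent_ge0 (R : realType) (b x y : R) : 0 < b -> 0 <= y ->
  0 <= scalar_bregman (ent b) (ent_deriv b) x y.
Proof.
move=> b0 y0; apply: le_trans (bregman_ent_ge _ b0 y0).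
by rewrite divr_ge0 ?sqr_ge0// mulr_ge0// !addr_ge0// ?mulr_ge0// ltW.
Qed.

(** The companion of [bregman_ent_ge]: the second derivative is at most
    [1 / b], and a factor 2 is given away. *)
Lemma bregman_ent_le (R : realType) (b x y : R) : 0 < b -> 0 <= y ->
  scalar_bregman (ent b) (ent_deriv b) x y <= (x - y) ^+ 2 / b.
Proof.
move=> b0 y0; have P u v : 0 <= u -> 0 <= v ->
    scalar_bregman (ent b) (ent_deriv b) u v <= (u - v) ^+ 2 / b.
  move=> u0 v0; rewrite bregman_ent_nonneg//.
  apply: (@le_trans _ _ ((u + b - (v + b)) ^+ 2 / (v + b))).
    by apply: relative_entropy_le; lra.
  have -> : u + b - (v + b) = u - v by ring.
  rewrite ler_wpM2l ?sqr_ge0// lef_pV2 ?posrE; lra.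
have [x0|x0] := leP 0 x; first exact: P.
have [u u0 ->] : exists2 u, 0 <= u & x = - u.
  by exists (- x); rewrite ?opprK//; lra.
rewrite bregman_ent_opp//.
have h1 := P u 0 u0 (lexx 0); have h2 := P 0 y (lexx 0) y0.
have yb : 0 <= y / b by rewrite divr_ge0// ltW.
have h3 : ln (y / b + 1) <= y / b by have := @ln_le_subr1 R (y / b + 1); lra.
have h4 := ler_wpM2l u0 h3.
have e : (- u - y) ^+ 2 / b
  = (u - 0) ^+ 2 / b + (0 - y) ^+ 2 / b + u * (y / b) + u * (y / b) by field; rewrite gt_eqF.
have := mulr_ge0 u0 yb.
by lra.
Qed.

(** * The Frobenius inner product *)

Lemma frob_trace (R : realType) (m n : nat) (x y : 'M[R]_(m, n)) :
  frob_inner x y = \tr (x^T *m y).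
Proof.
rewrite /frob_inner exchange_big; apply: eq_bigr => j _.
by rewrite mxE; apply: eq_bigr => i _; rewrite mxE.
Qed.

Lemma frobC (R : realType) (m n : nat) (x y : 'M[R]_(m, n)) :
  frob_inner x y = frob_inner y x.
Proof. by rewrite frob_trace -mxtrace_tr trmx_mul trmxK frob_trace. Qed.

Lemma frobDr (R : realType) (m n : nat) (x y z : 'M[R]_(m, n)) :
  frob_inner x (y + z) = frob_inner x y + frob_inner x z.
Proof. by rewrite !frob_trace mulmxDr mxtraceD. Qed.

Lemma frobZr (R : realType) (m n : nat) (a : R) (x y : 'M[R]_(m, n)) :
  frob_inner x (a *: y) = a * frob_inner x y.
Proof. by rewrite !frob_trace -scalemxAr mxtraceZ. Qed.

Lemma frobNr (R : realType) (m n : nat) (x y : 'M[R]_(m, n)) :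
  frob_inner x (- y) = - frob_inner x y.
Proof. by rewrite -scaleN1r frobZr mulN1r. Qed.

Lemma frob0r (R : realType) (m n : nat) (x : 'M[R]_(m, n)) :
  frob_inner x 0 = 0.
Proof. by rewrite -(scale0r 0) frobZr mul0r. Qed.

Lemma frobDl (R : realType) (m n : nat) (x y z : 'M[R]_(m, n)) :
  frob_inner (x + y) z = frob_inner x z + frob_inner y z.
Proof. by rewrite -!(frobC z) frobDr. Qed.

Lemma frobZl (R : realType) (m n : nat) (a : R) (x y : 'M[R]_(m, n)) :
  frob_inner (a *: x) y = a * frob_inner x y.
Proof. by rewrite -!(frobC y) frobZr. Qed.

Lemma frobNl (R : realType) (m n : nat) (x y : 'M[R]_(m, n)) :
  frob_inner (- x) y = - frob_inner x y.
Proof. by rewrite -!(frobC y) frobNr. Qed.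

Lemma frobBr (R : realType) (m n : nat) (x y z : 'M[R]_(m, n)) :
  frob_inner x (y - z) = frob_inner x y - frob_inner x z.
Proof. by rewrite frobDr frobNr. Qed.

Lemma frobBl (R : realType) (m n : nat) (x y z : 'M[R]_(m, n)) :
  frob_inner (x - y) z = frob_inner x z - frob_inner y z.
Proof. by rewrite frobDl frobNl. Qed.

Lemma frob_delta (R : realType) (m n : nat) (x : 'M[R]_(m, n)) i j :
  frob_inner x (delta_mx i j) = x i j.
Proof.
rewrite /frob_inner (bigD1 i)//= (bigD1 j)//= !mxE !eqxx mulr1 !big1 ?addr0//.
  by move=> k ki; rewrite big1// => l _; rewrite mxE (negbTE ki) mulr0.
by move=> k ki; rewrite mxE (negbTE ki) andbF mulr0.
Qed.

Lemma frob_mull (R : realType) (m n p : nat) (A : 'M[R]_(m, n)) (B : 'M[R]_(n, p))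
    (C : 'M[R]_(m, p)) :
  frob_inner (A *m B) C = frob_inner B (A^T *m C).
Proof. by rewrite !frob_trace trmx_mul mulmxA. Qed.

Lemma frob_mulr (R : realType) (m n p : nat) (A : 'M[R]_(m, n)) (B : 'M[R]_(n, p))
    (C : 'M[R]_(m, p)) :
  frob_inner (A *m B) C = frob_inner A (C *m B^T).
Proof. by rewrite !frob_trace trmx_mul -mulmxA mxtrace_mulC mulmxA. Qed.

Lemma frob_ge0 (R : realType) (m n : nat) (x : 'M[R]_(m, n)) :
  0 <= frob_inner x x.
Proof.
by apply: sumr_ge0 => i _; apply: sumr_ge0 => j _; rewrite -expr2 sqr_ge0.
Qed.

Lemma frob_entry (R : realType) (m n : nat) (x : 'M[R]_(m, n)) i j :
  x i j ^+ 2 <= frob_inner x x.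
Proof.
rewrite /frob_inner (bigD1 i)//= (bigD1 j)//= -expr2 -addrA lerDl addr_ge0//.
  by apply: sumr_ge0 => k _; rewrite -expr2 sqr_ge0.
by apply: sumr_ge0 => k _; apply: sumr_ge0 => l _; rewrite -expr2 sqr_ge0.
Qed.

Lemma frob_eq0 (R : realType) (m n : nat) (x : 'M[R]_(m, n)) :
  frob_inner x x <= 0 -> x = 0.
Proof.
move=> h; apply/matrixP => i j; rewrite mxE; apply/eqP.
by rewrite -sqrf_eq0 eq_le sqr_ge0 (le_trans (frob_entry x i j)).
Qed.

(** The discriminant of the nonnegative quadratic [|a y - c x|^2]. *)
Lemma frob_CS (R : realType) (m n : nat) (x y : 'M[R]_(m, n)) :
  frob_inner x y ^+ 2 <= frob_inner x x * frob_inner y y.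
Proof.
have [h|h] := leP (frob_inner y y) 0.
  by rewrite (frob_eq0 h) !frob0r mulr0 expr0n.
rewrite -(ler_pM2r h).
have := frob_ge0 (frob_inner y y *: x - frob_inner x y *: y).
rewrite frobDr !frobDl !frobNr !frobNl !frobZl !frobZr (frobC y x).
set a := frob_inner x x; set b := frob_inner y y; set c := frob_inner x y => H.
by nra.
Qed.

(** * Existence of singular value decompositions *)

Lemma continuous_sumr (R : realType) (T : topologicalType) (I : Type)
    (r : seq I) (f : I -> T -> R) :
  (forall i, continuous (f i)) -> continuous (fun x => \sum_(i <- r) f i x).
Proof.
move=> cf; elim: r => [|i r IH] x.
  rewrite (_ : (fun x => _) = fun=> 0); first exact: cvg_cst.
  by apply/funext => y; rewrite big_nil.
rewrite (_ : (fun x => _) = f i \+ fun x => \sum_(i <- r) f i x).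
  by apply: cvgD; [exact: cf|exact: IH].
by apply/funext => y; rewrite big_cons.
Qed.

Lemma continuous_frob_mulmx (R : realType) (m n : nat) (X : 'M[R]_(m, n)) :
  continuous (fun v : 'rV[R]_m => frob_inner (v *m X) (v *m X)).
Proof.
apply: continuous_sumr => i; apply: continuous_sumr => j.
have c : continuous (fun v : 'rV[R]_m => (v *m X) i j).
  rewrite (_ : (fun v => _) = fun v : 'rV[R]_m => \sum_k v i k * X k j).
    apply: continuous_sumr => k v.
    by apply: continuousM; [exact: coord_continuous|exact: cst_continuous].
  by apply/funext => v; rewrite mxE.
by move=> v; apply: continuousM; exact: c.
Qed.

Lemma frob_sphere_compact (R : realType) (n : nat) :
  compact [set v : 'rV[R]_n | frob_inner v v = 1].
Proof.
apply: bounded_closed_compact.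
  exists 1; split; first exact: num_real.
  move=> M M1 v /= v1.
  rewrite [leLHS]/Num.Def.normr /= mx_normrE; apply/bigmax_leP; split => /=.
    by apply: ltW; lra.
  move=> -[i j] _ /=.
  have := frob_entry v i j; rewrite v1 => h.
  rewrite -(@ler_pXn2r _ 2) ?nnegrE//; last by lra.
  rewrite real_normK ?num_real//.
  by apply: (le_trans h); rewrite expr_ge1//; lra.
rewrite (_ : [set v | _] = (fun v : 'rV[R]_n => frob_inner v v) @^-1` [set 1])//.
apply: closed_comp; last exact: closed_eq.
move=> v _; have := @continuous_frob_mulmx R n n 1%:M v.
rewrite (_ : (fun v => _) = fun v : 'rV[R]_n => frob_inner v v)//.
by apply/funext => w; rewrite mulmx1.
Qed.

Lemma maximal_unit_vector (R : realType) (m n : nat) (X : 'M[R]_(m.+1, n)) :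
  exists2 v : 'rV[R]_m.+1, frob_inner v v = 1 &
    forall w : 'rV[R]_m.+1, frob_inner (w *m X) (w *m X)
      <= frob_inner (v *m X) (v *m X) * frob_inner w w.
Proof.
pose q (w : 'rV[R]_m.+1) := frob_inner (w *m X) (w *m X).
have ne : [set v : 'rV[R]_m.+1 | frob_inner v v = 1] !=set0.
  exists (delta_mx 0 0) => /=; rewrite /frob_inner big_ord1 (bigD1 0)//= big1.
    by rewrite !mxE/= mulr1 addr0.
  by move=> i /negbTE i0; rewrite !mxE eqxx i0 /= mulr0.
have qc : {within [set v : 'rV[R]_m.+1 | frob_inner v v = 1], continuous q}.
  exact/continuous_subspaceT/continuous_frob_mulmx.
have [v v1 vmax] := EVT_max_rV ne (@frob_sphere_compact R _) qc.
exists v => [|w]; first by rewrite inE in v1.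
have [h|h] := leP (frob_inner w w) 0.
  by rewrite (frob_eq0 h) mul0mx !frob0r mulr0.
pose a := (Num.sqrt (frob_inner w w))^-1.
have a2 : a ^+ 2 = (frob_inner w w)^-1 by rewrite exprVn sqr_sqrtr// ltW.
have := vmax (a *: w); rewrite inE /= frobZl frobZr mulrA -expr2 a2.
rewrite mulVf ?gt_eqF// => /(_ erefl).
rewrite /q -scalemxAl frobZl frobZr mulrA -expr2 a2.
by rewrite mulrC ler_pdivrMr.
Qed.

(** The reflection exchanging two unit vectors. *)
Lemma householder (R : realType) (n : nat) (e u : 'rV[R]_n) :
  frob_inner e e = 1 -> frob_inner u u = 1 ->
  exists H : 'M[R]_n, [/\ H^T = H, H *m H = 1%:M & e *m H = u].
Proof.
move=> e1 u1; pose w := e - u; pose k := frob_inner w w.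
have [h|h] := leP k 0.
  exists 1%:M; rewrite trmx1 mulmx1; split => //.
  by rewrite mulmx1; apply/eqP; rewrite -subr_eq0 -/w (frob_eq0 h).
have dot (x y : 'rV[R]_n) : x *m y^T = (frob_inner x y)%:M.
  by rewrite [LHS]mx11_scalar frobC frob_trace mxtrace_mulC trace_mx11.
have kE : k = 2 * (1 - frob_inner e u).
  rewrite /k /w frobDr !frobDl !frobNr !frobNl e1 u1 (frobC u e); ring.
pose H : 'M[R]_n := 1%:M - (2 / k) *: (w^T *m w).
have ww : (w^T *m w) *m (w^T *m w) = k *: (w^T *m w).
  by rewrite mulmxA -(mulmxA w^T) dot mul_mx_scalar -scalemxAl.
have k0 : k != 0 by rewrite gt_eqF.
exists H; split.
- by rewrite /H linearB /= trmx1 linearZ /= trmx_mul trmxK.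
- rewrite /H; move: (w^T *m w) ww => P ww.
  rewrite mulmxBl mul1mx mulmxBr mulmx1 -scalemxAl -scalemxAr ww !scalerA.
  by apply/matrixP => i j; rewrite !mxE; field; exact: k0.
- rewrite /H mulmxBr mulmx1 -scalemxAr mulmxA dot mul_scalar_mx scalerA.
  rewrite (_ : 2 / k * _ = 1) ?scale1r ?/w ?subKr// /w frobDr frobNr e1 kE.
  by field; move: k0; rewrite kE mulf_eq0 negb_or => /andP[].
Qed.

Definition rect_diag (R : realType) (m n : nat) (s : nat -> R) : 'M[R]_(m, n) :=
  \matrix_(i, j) (s i *+ (i == j :> nat)).

Lemma rect_diag_block (R : realType) (m n : nat) (s : nat -> R) :
  rect_diag (1 + m) (1 + n) s
  = block_mx (s 0%N)%:M 0 0 (rect_diag m n (fun k => s k.+1)).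
Proof.
apply/matrixP => i j; rewrite !mxE.
case: splitP => i' hi; rewrite !mxE; case: splitP => j' hj; rewrite !mxE hi hj.
- by rewrite !ord1.
- by rewrite !ord1.
- by rewrite !ord1.
- by rewrite /= eqSS.
Qed.

Lemma frob_row_mx0 (R : realType) (n : nat) (w : 'rV[R]_n) :
  frob_inner (row_mx (0 : 'rV_1) w) (row_mx 0 w) = frob_inner w w.
Proof.
rewrite !frob_trace tr_row_mx mul_col_row mxtrace_block trmx0 mul0mx.
by rewrite mxtrace0 add0r.
Qed.

Lemma frob_isometry (R : realType) (m n : nat) (H : 'M[R]_n) (w : 'M[R]_(m, n)) :
  H^T = H -> H *m H = 1%:M -> frob_inner (w *m H) (w *m H) = frob_inner w w.
Proof. by move=> Ht HH; rewrite frob_mulr Ht -mulmxA HH mulmx1. Qed.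

(** Reflections bring a maximal unit vector and its image to the first basis
    vectors; maximality then makes the rest of the first row and column vanish.
    The third conclusion transports the maximality of the leading singular
    value through the induction, which sorts the values. *)
Lemma full_svd (R : realType) (m n : nat) (X : 'M[R]_(m, n)) :
  exists (U : 'M[R]_m) (V : 'M[R]_n) (s : nat -> R),
    [/\ U^T *m U = 1%:M /\ V^T *m V = 1%:M,
        (forall k, 0 <= s k) /\ (forall k l, (k <= l)%N -> s l <= s k),
        forall c, 0 <= c ->
          (forall w : 'rV[R]_m, frob_inner (w *m X) (w *m X) <= c ^+ 2 * frob_inner w w) ->
          s 0%N <= c &
        X = U *m rect_diag m n s *m V^T].
Proof.
have triv p r : exists (U : 'M[R]_p) (V : 'M[R]_r) (s : nat -> R),
    [/\ U^T *m U = 1%:M /\ V^T *m V = 1%:M,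
        (forall k, 0 <= s k) /\ (forall k l, (k <= l)%N -> s l <= s k),
        forall c, 0 <= c ->
          (forall w : 'rV[R]_p, frob_inner (w *m (0 : 'M[R]_(p, r))) (w *m (0 : 'M[R]_(p, r))) <= c ^+ 2 * frob_inner w w) ->
          s 0%N <= c &
        (0 : 'M[R]_(p, r)) = U *m rect_diag p r s *m V^T].
  exists 1%:M, 1%:M, (fun=> 0); rewrite !trmx1 !mulmx1; split => //.
  rewrite mul1mx; apply/matrixP => i j; rewrite !mxE; by rewrite mul0rn.
elim: m n X => [|m IH] [|n] X; rewrite ?(flatmx0 X) ?(thinmx0 X); try exact: triv.
have [v v1 vmax] := maximal_unit_vector X.
pose sg := Num.sqrt (frob_inner (v *m X) (v *m X)).
have sg2 : sg ^+ 2 = frob_inner (v *m X) (v *m X) by rewrite sqr_sqrtr// frob_ge0.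
have [sg0|sg0] := eqVneq sg 0.
  suff -> : X = 0 by exact: triv.
  apply/row_matrixP => i; rewrite row0 rowE; apply: frob_eq0.
  by apply: le_trans (vmax _) _; rewrite -sg2 sg0 expr0n mul0r.
have sgp : 0 < sg by rewrite lt_neqAle eq_sym sg0 sqrtr_ge0.
pose u := sg^-1 *: (v *m X).
have vX : v *m X = sg *: u by rewrite scalerA divff// scale1r.
have u1 : frob_inner u u = 1.
  by rewrite frobZl frobZr -sg2 expr2 mulrA -mulrA mulKf// mulVf.
(* Maximality in the other direction: [u X^T] has norm at most [sg], which is
   also its inner product with the unit vector [v]. *)
have uX : u *m X^T = sg *: v.
  apply/eqP; rewrite -subr_eq0; apply/eqP; apply: frob_eq0.
  have uv : frob_inner (u *m X^T) v = sg.
    by rewrite frob_mulr trmxK vX frobZr u1 mulr1.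
  set w := u *m X^T in uv *.
  have ww : frob_inner w w <= sg ^+ 2.
    have h1 : frob_inner w w = frob_inner u (w *m X) by rewrite {1}/w frob_mulr trmxK.
    have h2 := frob_CS u (w *m X); rewrite -h1 u1 mul1r in h2.
    have h3 := le_trans h2 (vmax w); rewrite -sg2 in h3.
    have [->|w0] := eqVneq (frob_inner w w) 0; first exact: sqr_ge0.
    have wp : 0 < frob_inner w w by rewrite lt_neqAle eq_sym w0 frob_ge0.
    by rewrite expr2 ler_pM2r in h3.
  rewrite frobDr !frobDl !frobNr !frobNl !frobZl !frobZr (frobC v w) uv v1; nra.
(* [e p] is the first basis vector, the target of the reflections. *)
pose e p : 'rV[R]_(1 + p) := row_mx 1%:M 0.
have e1 p : frob_inner (e p) (e p) = 1.
  rewrite frob_trace tr_row_mx mul_col_row mxtrace_block.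
  by rewrite trmx1 mulmx1 mulmx0 mxtrace0 addr0 mxtrace1.
have [H [Ht HH eH]] := householder (e1 m) v1.
have [G [Gt GG eG]] := householder (e1 n) u1.
have uG : u *m G = e n by rewrite -eG -mulmxA GG mulmx1.
have vH : v *m H = e m by rewrite -eH -mulmxA HH mulmx1.
pose Z : 'M[R]_(1 + m, 1 + n) := H *m X *m G.
have eZ : e m *m Z = sg *: e n.
  by rewrite /Z !mulmxA eH vX -scalemxAl uG.
have eZt : e n *m Z^T = sg *: e m.
  by rewrite /Z !trmx_mul Ht Gt !mulmxA eG uX -scalemxAl vH.
have ZB : Z = block_mx sg%:M 0 0 (drsubmx Z).
  move: eZ eZt; rewrite -[Z]submxK tr_block_mx /e !mul_row_block.
  rewrite !mul1mx !mul0mx !addr0 !scale_row_mx !scaler0 !scalemx1.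
  move=> /eq_row_mx[-> ->] /eq_row_mx[_ h].
  by rewrite !block_mxKdr -[dlsubmx _]trmxK h trmx0.
have XZ : X = H *m Z *m G.
  by rewrite /Z !mulmxA HH mul1mx -mulmxA GG mulmx1.
have [U [V [s [[UU VV] [s0 ss] sc XE]]]] := IH _ (drsubmx Z).
pose U1 : 'M[R]_(1 + m) := block_mx 1%:M 0 0 U.
pose V1 : 'M[R]_(1 + n) := block_mx 1%:M 0 0 V.
have s0sg : s 0%N <= sg.
  apply: sc => [|w]; first exact: ltW.
  have -> : frob_inner (w *m drsubmx Z) (w *m drsubmx Z)
      = frob_inner (row_mx (0 : 'rV_1) w *m H *m X) (row_mx (0 : 'rV_1) w *m H *m X).
    rewrite -[RHS](frob_isometry _ Gt GG) -!mulmxA (mulmxA H) -/Z ZB.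
    by rewrite mul_row_block !mul0mx !mulmx0 !add0r block_mxKdr frob_row_mx0.
  apply: le_trans (vmax _) _; rewrite -sg2 ler_wpM2l ?sqr_ge0//.
  by rewrite frob_isometry// frob_row_mx0.
pose s1 k := if k is k'.+1 then s k' else sg.
have orth p (W : 'M[R]_p) : W^T *m W = 1%:M ->
    (block_mx 1%:M 0 0 W : 'M[R]_(1 + p))^T *m block_mx 1%:M 0 0 W = 1%:M.
  move=> WW; rewrite tr_block_mx !trmx0 trmx1 mulmx_block.
  by rewrite !mulmx0 !mul0mx mulmx1 !addr0 !add0r WW -scalar_mx_block.
have UU1 : U1^T *m U1 = 1%:M := orth _ _ UU.
have VV1 : V1^T *m V1 = 1%:M := orth _ _ VV.
have ZE : Z = U1 *m rect_diag (1 + m) (1 + n) s1 *m V1^T.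
  rewrite ZB rect_diag_block XE tr_block_mx !trmx0 trmx1 !mulmx_block.
  by rewrite !mulmx0 !mul0mx !mulmx1 !mul1mx !addr0 !add0r !mul0mx.
exists (H *m U1), (G *m V1), s1; split.
- split; rewrite trmx_mul ?Ht ?Gt -mulmxA.
    by rewrite (mulmxA H) HH mul1mx; exact: UU1.
  by rewrite (mulmxA G) GG mul1mx; exact: VV1.
- split => [[|k]|[|k] [|l]]//=; first exact: ltW.
    by move=> _; apply: le_trans s0sg; exact: ss.
  by rewrite ltnS; exact: ss.
- move=> c c0 /(_ v); rewrite -sg2 v1 mulr1 => h.
  by rewrite -(@ler_pXn2r _ 2)// nnegrE// ltW.
- by rewrite {1}XZ ZE trmx_mul Gt !mulmxA.
Qed.

(** The thin decomposition keeps the first [minn m n] columns of a full one,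
    selected by the matrices [E]. *)
Lemma singular_valuesP (R : realType) (m n : nat) (X : 'M[R]_(m, n)) :
  is_singular_values X (singular_values X).
Proof.
suff [s hs] : exists s, is_singular_values X s.
  exact: (@xgetPex _ 0 [set s | is_singular_values X s] (ex_intro _ s hs)).
have [U [V [s [[UU VV] [s0 ss] _ XE]]]] := full_svd X.
set d := minn m n.
pose E p : 'M[R]_(p, d) := \matrix_(i, k) (i == k :> nat)%:R.
have EE p : (d <= p)%N -> (E p)^T *m E p = 1%:M.
  move=> dp; apply/matrixP => k l; rewrite !mxE.
  rewrite (bigD1 (widen_ord dp k))//= !mxE eqxx mul1r big1 ?addr0// => i ik.
  rewrite !mxE (_ : (i == k :> nat) = false) ?mul0r//.
  by apply: contra_neqF ik => /eqP ik; apply: val_inj.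
pose s' : 'rV[R]_d := \row_k s k.
have DE : rect_diag m n s = E m *m diag_mx s' *m (E n)^T.
  apply/matrixP => i j; rewrite mul_mx_diag !mxE.
  have [ij|ij] := eqVneq (i : nat) j.
    have id : (i < d)%N by rewrite leq_min ltn_ord ij ltn_ord.
    rewrite (bigD1 (Ordinal id))//= !mxE /= -ij !eqxx mul1r mulr1 big1 ?addr0//.
    move=> k ik; rewrite !mxE (_ : (i == k :> nat) = false) ?mul0r//.
    by apply: contra_neqF ik => /eqP ik; apply: val_inj; rewrite /= ik.
  rewrite big1// => k _; rewrite !mxE.
  have [ik|] := eqVneq (i : nat) k; last by rewrite !mul0r.
  by rewrite (_ : (j == k :> nat) = false) ?mulr0// -ik eq_sym; apply/negbTE.
exists s'; split => [k|k l kl|]; rewrite ?mxE//; first exact: ss.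
exists (U *m E m), (V *m E n); split.
- by rewrite trmx_mul -mulmxA (mulmxA U^T) UU mul1mx EE// geq_minl.
- by rewrite trmx_mul -mulmxA (mulmxA V^T) VV mul1mx EE// geq_minr.
- by rewrite XE DE trmx_mul !mulmxA.
Qed.

(** * Matrices with orthonormal columns and operator bounds *)

Lemma bessel_residual (R : realType) (m d p : nat) (U : 'M[R]_(m, d)) (x : 'M[R]_(m, p)) :
  U^T *m U = 1%:M ->
  frob_inner (x - U *m (U^T *m x)) (x - U *m (U^T *m x))
  = frob_inner x x - frob_inner (U^T *m x) (U^T *m x).
Proof.
move=> UU; set y := U^T *m x.
have xy : frob_inner (U *m y) x = frob_inner y y by rewrite frob_mull.
have yy : frob_inner (U *m y) (U *m y) = frob_inner y y.
  by rewrite frob_mull mulmxA UU mul1mx.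
rewrite frobDr !frobDl !frobNr !frobNl (frobC x) xy yy; ring.
Qed.

Lemma bessel (R : realType) (m d p : nat) (U : 'M[R]_(m, d)) (x : 'M[R]_(m, p)) :
  U^T *m U = 1%:M -> frob_inner (U^T *m x) (U^T *m x) <= frob_inner x x.
Proof. by move=> UU; rewrite -subr_ge0 -bessel_residual// frob_ge0. Qed.

(** The spectral norm of [W] is at most [c], for [0 <= c], in the form that
    Bessel's inequality can be applied to. *)
Definition op_le (R : realType) (m n : nat) (c : R) (W : 'M[R]_(m, n)) : Prop :=
  forall x : 'cV[R]_n, frob_inner (W *m x) (W *m x) <= c ^+ 2 * frob_inner x x.

(** With [w = W^T y], Cauchy-Schwarz bounds [|w|^2 = <y, W w>] by
    [c |y| |w|]. *)
Lemma op_le_tr (R : realType) (m n : nat) (c : R) (W : 'M[R]_(m, n)) :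
  op_le c W -> op_le c W^T.
Proof.
move=> h y; set w := W^T *m y.
have h1 : frob_inner w w = frob_inner y (W *m w).
  by rewrite {1}/w frob_mull trmxK.
have h2 := frob_CS y (W *m w); rewrite -h1 in h2.
have h3 := h w.
have [->|w0] := eqVneq (frob_inner w w) 0.
  by rewrite mulr_ge0 ?sqr_ge0 ?frob_ge0.
have wp : 0 < frob_inner w w by rewrite lt_neqAle eq_sym w0 frob_ge0.
rewrite -(ler_pM2r wp) -expr2; apply: (le_trans h2).
rewrite mulrAC mulrC ler_wpM2r ?frob_ge0//.
Qed.

Lemma op_leN (R : realType) (m n : nat) (c : R) (W : 'M[R]_(m, n)) :
  op_le c W -> op_le c (- W).
Proof. by move=> h x; rewrite mulNmx frobNl frobNr opprK. Qed.

Lemma op_le_svd (R : realType) (m n d : nat) (c : R) (U : 'M[R]_(m, d))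
    (s : 'rV[R]_d) (V : 'M[R]_(n, d)) :
  U^T *m U = 1%:M -> V^T *m V = 1%:M -> (forall i, `|s 0 i| <= c) ->
  op_le c (U *m diag_mx s *m V^T).
Proof.
move=> UU VV sc x; rewrite -!mulmxA frob_mull (mulmxA U^T) UU mul1mx.
apply: le_trans (ler_wpM2l (sqr_ge0 c) (bessel x VV)).
rewrite /frob_inner mulr_sumr; apply: ler_sum => i _; rewrite !big_ord1.
set z := V^T *m x; rewrite mul_diag_mx !mxE -!expr2 exprMn.
rewrite ler_wpM2r ?sqr_ge0// -[s 0 i ^+ 2]real_normK ?num_real//.
by rewrite ler_pXn2r ?nnegrE// (le_trans _ (sc i)).
Qed.

Lemma spectral_norm_ge0 (R : realType) (m n : nat) (W : 'M[R]_(m, n)) :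
  0 <= spectral_norm W.
Proof. by rewrite /spectral_norm; apply: bigmax_ge_id. Qed.

Lemma op_le_spectral_norm (R : realType) (m n : nat) (W : 'M[R]_(m, n)) :
  op_le (spectral_norm W) W.
Proof.
have [s0 _ [U [V [UU VV WE]]]] := singular_valuesP W.
rewrite [W in op_le _ W]WE; apply: op_le_svd => // i.
by rewrite ger0_norm// /spectral_norm le_bigmax.
Qed.

Lemma frob_col (R : realType) (m n : nat) (x : 'M[R]_(m, n)) j :
  frob_inner (col j x) (col j x) = \sum_i x i j ^+ 2.
Proof. by apply: eq_bigr => i _; rewrite big_ord1 !mxE. Qed.

Lemma frob_orth_col (R : realType) (m d : nat) (U : 'M[R]_(m, d)) j :
  U^T *m U = 1%:M -> frob_inner (col j U) (col j U) = 1.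
Proof.
move=> /matrixP/(_ j j); rewrite frob_col !mxE eqxx => E; rewrite -[RHS]E.
by apply: eq_bigr => i _; rewrite !mxE.
Qed.

Lemma op_le_col (R : realType) (m n d e : nat) (c : R) (W : 'M[R]_(m, n))
    (U : 'M[R]_(m, d)) (V : 'M[R]_(n, e)) (j : 'I_e) :
  op_le c W -> U^T *m U = 1%:M -> V^T *m V = 1%:M ->
  \sum_i (U^T *m W *m V) i j ^+ 2 <= c ^+ 2.
Proof.
move=> hW UU VV; rewrite -frob_col colE -!mulmxA -colE.
apply: le_trans (bessel _ UU) _.
by apply: le_trans (hW _) _; rewrite frob_orth_col// mulr1.
Qed.

Lemma op_le_row (R : realType) (m n d e : nat) (c : R) (W : 'M[R]_(m, n))
    (U : 'M[R]_(m, d)) (V : 'M[R]_(n, e)) (i : 'I_d) :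
  op_le c W -> U^T *m U = 1%:M -> V^T *m V = 1%:M ->
  \sum_j (U^T *m W *m V) i j ^+ 2 <= c ^+ 2.
Proof.
move=> hW UU VV; have := op_le_col i (op_le_tr hW) VV UU.
rewrite (_ : V^T *m W^T *m U = (U^T *m W *m V)^T); last first.
  by rewrite !trmx_mul trmxK mulmxA.
by congr (_ <= _); apply: eq_bigr => j _; rewrite mxE.
Qed.

(** * Comparing two singular value decompositions *)

Lemma frob_diag (R : realType) (d : nat) (a : 'rV[R]_d) (Z : 'M[R]_d) :
  frob_inner (diag_mx a) Z = \sum_i a 0 i * Z i i.
Proof.
rewrite /frob_inner; apply: eq_bigr => i _.
rewrite (bigD1 i)//= !mxE eqxx mulr1n big1 ?addr0// => j ji.
by rewrite !mxE eq_sym (negbTE ji) mulr0n mul0r.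
Qed.

Lemma frob_svd (R : realType) (m n d : nat) (U P : 'M[R]_(m, d))
    (V Q : 'M[R]_(n, d)) (a s : 'rV[R]_d) :
  frob_inner (U *m diag_mx a *m V^T) (P *m diag_mx s *m Q^T)
  = \sum_i \sum_j a 0 i * s 0 j * ((U^T *m P) i j * (V^T *m Q) i j).
Proof.
rewrite -mulmxA frob_mull frob_mulr trmxK frob_diag; apply: eq_bigr => i _.
have -> : U^T *m (P *m diag_mx s *m Q^T) *m V
    = U^T *m P *m diag_mx s *m (V^T *m Q)^T by rewrite trmx_mul trmxK !mulmxA.
rewrite mxE mulr_sumr; apply: eq_bigr => j _.
by rewrite mul_mx_diag !mxE; ring.
Qed.

Lemma frob_svd_same (R : realType) (m n d : nat) (U : 'M[R]_(m, d))
    (V : 'M[R]_(n, d)) (a s : 'rV[R]_d) :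
  U^T *m U = 1%:M -> V^T *m V = 1%:M ->
  frob_inner (U *m diag_mx a *m V^T) (U *m diag_mx s *m V^T)
  = \sum_i a 0 i * s 0 i.
Proof.
move=> UU VV; rewrite frob_svd; apply: eq_bigr => i _.
rewrite UU VV (bigD1 i)//= !mxE eqxx mulr1 mulr1 big1 ?addr0// => j ji.
by rewrite !mxE eq_sym (negbTE ji) mulr0 mulr0.
Qed.

(** The symmetric dilation of [X], with zero diagonal blocks and off-diagonal
    blocks [X] and [X^T], has the eigenvectors [(p_j, q_j) / sqrt 2] and
    [(p_j, - q_j) / sqrt 2] for the eigenvalues [s_j] and [- s_j].  The weights
    are the squared inner products of [(u_i, v_i) / sqrt 2] with these two
    vectors. *)
Definition weight_plus (R : realType) (m n d : nat) (U P : 'M[R]_(m, d))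
    (V Q : 'M[R]_(n, d)) (i j : 'I_d) : R :=
  (((U^T *m P) i j + (V^T *m Q) i j) / 2) ^+ 2.

Definition weight_minus (R : realType) (m n d : nat) (U P : 'M[R]_(m, d))
    (V Q : 'M[R]_(n, d)) (i j : 'I_d) : R :=
  (((U^T *m P) i j - (V^T *m Q) i j) / 2) ^+ 2.

Definition weight (R : realType) (m n d : nat) (U P : 'M[R]_(m, d))
    (V Q : 'M[R]_(n, d)) (i j : 'I_d) : R :=
  weight_plus U P V Q i j + weight_minus U P V Q i j.

Lemma weightE (R : realType) (m n d : nat) (U P : 'M[R]_(m, d))
    (V Q : 'M[R]_(n, d)) (i j : 'I_d) :
  weight U P V Q i j = ((U^T *m P) i j ^+ 2 + (V^T *m Q) i j ^+ 2) / 2.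
Proof. by rewrite /weight /weight_plus /weight_minus; field. Qed.

Lemma mulmx_tr_swap (R : realType) (p d : nat) (A B : 'M[R]_(p, d)) (i j : 'I_d) :
  (B^T *m A) j i = (A^T *m B) i j.
Proof. by rewrite !mxE; apply: eq_bigr => k _; rewrite !mxE mulrC. Qed.

Lemma weightC (R : realType) (m n d : nat) (U P : 'M[R]_(m, d))
    (V Q : 'M[R]_(n, d)) (i j : 'I_d) :
  weight P U Q V j i = weight U P V Q i j.
Proof.
by rewrite !weightE !(mulmx_tr_swap _ _ i j).
Qed.

Definition spectral_gradient (R : realType) (m n d : nat) (f' : R -> R)
    (U : 'M[R]_(m, d)) (t : 'rV[R]_d) (V : 'M[R]_(n, d)) : 'M[R]_(m, n) :=
  U *m diag_mx (\row_i f' (t 0 i)) *m V^T.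

(** The divergence of the spectral function of [f], with the expected gradient
    in place of the derivative: differentiability is a consequence of the
    estimates on this quantity. *)
Definition svd_bregman (R : realType) (m n d : nat) (f f' : R -> R)
    (P : 'M[R]_(m, d)) (s : 'rV[R]_d) (Q : 'M[R]_(n, d))
    (U : 'M[R]_(m, d)) (t : 'rV[R]_d) (V : 'M[R]_(n, d)) : R :=
  \sum_j f (s 0 j) - \sum_i f (t 0 i)
  - frob_inner (spectral_gradient f' U t V)
      (P *m diag_mx s *m Q^T - U *m diag_mx t *m V^T).

(** Expanding [<U f'(t) V^T, X>] gives the coefficients
    [(U^T P)_ij * (V^T Q)_ij], and a product is the difference of the squares of
    the half sum and the half difference.  The minus sign is absorbed in the
    argument [- s_j] because [f] is even.  Rows and columns of weights sum to at
    most 1; the missing mass is carried by divergences to or from 0. *)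
Lemma svd_bregman_decomp (R : realType) (m n d : nat) (f f' : R -> R)
    (P : 'M[R]_(m, d)) (s : 'rV[R]_d) (Q : 'M[R]_(n, d))
    (U : 'M[R]_(m, d)) (t : 'rV[R]_d) (V : 'M[R]_(n, d)) :
  (forall v, f (- v) = f v) -> f 0 = 0 -> f' 0 = 0 ->
  U^T *m U = 1%:M -> V^T *m V = 1%:M ->
  svd_bregman f f' P s Q U t V
  = \sum_i \sum_j (weight_plus U P V Q i j * scalar_bregman f f' (s 0 j) (t 0 i)
                 + weight_minus U P V Q i j * scalar_bregman f f' (- s 0 j) (t 0 i))
    + \sum_j (1 - \sum_i weight U P V Q i j) * scalar_bregman f f' (s 0 j) 0
    + \sum_i (1 - \sum_j weight U P V Q i j) * scalar_bregman f f' 0 (t 0 i).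
Proof.
move=> fN f0 f'0 UU VV.
rewrite /svd_bregman frobDr frobNr frob_svd frob_svd_same//.
set w := weight U P V Q.
have b0 y : scalar_bregman f f' 0 y = f' y * y - f y.
  by rewrite /scalar_bregman f0; ring.
have bx0 x : scalar_bregman f f' x 0 = f x.
  by rewrite /scalar_bregman f0 f'0; ring.
pose c i := f' (t 0 i) * t 0 i - f (t 0 i).
have E i j : weight_plus U P V Q i j * scalar_bregman f f' (s 0 j) (t 0 i)
    + weight_minus U P V Q i j * scalar_bregman f f' (- s 0 j) (t 0 i)
    = w i j * f (s 0 j) + w i j * c i
      - f' (t 0 i) * s 0 j * ((U^T *m P) i j * (V^T *m Q) i j).
  by rewrite /w /weight /weight_plus /weight_minus /scalar_bregman fN /c; field.
have e0 : \sum_i \sum_j (weight_plus U P V Q i j * scalar_bregman f f' (s 0 j) (t 0 i)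
      + weight_minus U P V Q i j * scalar_bregman f f' (- s 0 j) (t 0 i))
    = \sum_j \sum_i w i j * f (s 0 j) + \sum_i \sum_j w i j * c i
      - \sum_i \sum_j f' (t 0 i) * s 0 j * ((U^T *m P) i j * (V^T *m Q) i j).
  rewrite [X in _ = X + _ - _]exchange_big -big_split -sumrB /=.
  apply: eq_bigr => i _; rewrite -big_split -sumrB /=.
  by apply: eq_bigr => j _; rewrite E.
have e1 : \sum_j (1 - \sum_i w i j) * scalar_bregman f f' (s 0 j) 0
    = \sum_j f (s 0 j) - \sum_j \sum_i w i j * f (s 0 j).
  rewrite -sumrB; apply: eq_bigr => j _.
  by rewrite bx0 mulrBl mul1r mulr_suml.
have e2 : \sum_i (1 - \sum_j w i j) * scalar_bregman f f' 0 (t 0 i)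
    = \sum_i c i - \sum_i \sum_j w i j * c i.
  rewrite -sumrB; apply: eq_bigr => i _.
  by rewrite b0 mulrBl mul1r mulr_suml.
have e3 : \sum_i c i = \sum_i (\row_k f' (t 0 k)) 0 i * t 0 i - \sum_i f (t 0 i).
  by rewrite -sumrB; apply: eq_bigr => i _; rewrite mxE.
have e4 : \sum_i \sum_j (\row_k f' (t 0 k)) 0 i * s 0 j * ((U^T *m P) i j * (V^T *m Q) i j)
    = \sum_i \sum_j f' (t 0 i) * s 0 j * ((U^T *m P) i j * (V^T *m Q) i j).
  by apply: eq_bigr => i _; apply: eq_bigr => j _; rewrite mxE.
rewrite e0 e1 e2 e3 e4; ring.
Qed.

Lemma weight_plus_ge0 (R : realType) (m n d : nat) (U P : 'M[R]_(m, d))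
    (V Q : 'M[R]_(n, d)) (i j : 'I_d) : 0 <= weight_plus U P V Q i j.
Proof. exact: sqr_ge0. Qed.

Lemma weight_minus_ge0 (R : realType) (m n d : nat) (U P : 'M[R]_(m, d))
    (V Q : 'M[R]_(n, d)) (i j : 'I_d) : 0 <= weight_minus U P V Q i j.
Proof. exact: sqr_ge0. Qed.

Lemma orth_residual (R : realType) (m d : nat) (U P : 'M[R]_(m, d)) (j : 'I_d) :
  U^T *m U = 1%:M -> P^T *m P = 1%:M ->
  frob_inner (col j P - U *m (U^T *m col j P)) (col j P - U *m (U^T *m col j P))
  = 1 - \sum_i (U^T *m P) i j ^+ 2.
Proof.
move=> UU PP; rewrite bessel_residual// frob_orth_col// -frob_col.
by rewrite [col j (U^T *m P)]colE [col j P]colE !mulmxA.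
Qed.

Lemma weight_residualE (R : realType) (m n d : nat) (U P : 'M[R]_(m, d))
    (V Q : 'M[R]_(n, d)) (j : 'I_d) :
  1 - \sum_i weight U P V Q i j
  = ((1 - \sum_i (U^T *m P) i j ^+ 2) + (1 - \sum_i (V^T *m Q) i j ^+ 2)) / 2.
Proof.
under eq_bigr do rewrite weightE.
by rewrite -mulr_suml big_split/=; field.
Qed.

Lemma weight_col_le1 (R : realType) (m n d : nat) (U P : 'M[R]_(m, d))
    (V Q : 'M[R]_(n, d)) (j : 'I_d) :
  U^T *m U = 1%:M -> V^T *m V = 1%:M -> P^T *m P = 1%:M -> Q^T *m Q = 1%:M ->
  0 <= 1 - \sum_i weight U P V Q i j.
Proof.
move=> UU VV PP QQ; rewrite weight_residualE -!orth_residual//.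
by rewrite divr_ge0// addr_ge0// frob_ge0.
Qed.

Lemma weight_row_le1 (R : realType) (m n d : nat) (U P : 'M[R]_(m, d))
    (V Q : 'M[R]_(n, d)) (i : 'I_d) :
  U^T *m U = 1%:M -> V^T *m V = 1%:M -> P^T *m P = 1%:M -> Q^T *m Q = 1%:M ->
  0 <= 1 - \sum_j weight U P V Q i j.
Proof.
move=> UU VV PP QQ; under eq_bigr do rewrite -weightC.
exact: weight_col_le1.
Qed.

Lemma svd_bregman_ent_ge0 (R : realType) (m n d : nat) (b : R)
    (P : 'M[R]_(m, d)) (s : 'rV[R]_d) (Q : 'M[R]_(n, d))
    (U : 'M[R]_(m, d)) (t : 'rV[R]_d) (V : 'M[R]_(n, d)) :
  0 < b -> (forall i, 0 <= t 0 i) ->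
  U^T *m U = 1%:M -> V^T *m V = 1%:M -> P^T *m P = 1%:M -> Q^T *m Q = 1%:M ->
  0 <= svd_bregman (ent b) (ent_deriv b) P s Q U t V.
Proof.
move=> b0 t0 UU VV PP QQ.
rewrite svd_bregman_decomp//; [|exact: entN|exact: ent0|exact: ent_deriv0].
rewrite !addr_ge0//; apply: sumr_ge0 => i _.
- apply: sumr_ge0 => j _.
  by rewrite addr_ge0// mulr_ge0// ?sqr_ge0// bregman_ent_ge0.
- by rewrite mulr_ge0// ?bregman_ent_ge0// weight_col_le1.
- by rewrite mulr_ge0// ?bregman_ent_ge0// weight_row_le1.
Qed.

Lemma frob_svd_sub (R : realType) (m n d : nat)
    (P : 'M[R]_(m, d)) (s : 'rV[R]_d) (Q : 'M[R]_(n, d))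
    (U : 'M[R]_(m, d)) (t : 'rV[R]_d) (V : 'M[R]_(n, d)) :
  U^T *m U = 1%:M -> V^T *m V = 1%:M -> P^T *m P = 1%:M -> Q^T *m Q = 1%:M ->
  let Z := P *m diag_mx s *m Q^T - U *m diag_mx t *m V^T in
  frob_inner Z Z = svd_bregman (fun v => v ^+ 2) (fun v => 2 * v) P s Q U t V.
Proof.
move=> UU VV PP QQ /=; set X := P *m _ *m _; set Y := U *m _ *m _.
rewrite /svd_bregman -/X -/Y.
have -> : spectral_gradient (fun v => 2 * v) U t V = 2 *: Y.
  rewrite /spectral_gradient /Y scalemxAl scalemxAr; congr (_ *m _ *m _).
  by apply/matrixP => i j; rewrite !mxE mulrnAr.
have -> : \sum_j s 0 j ^+ 2 = frob_inner X X by rewrite frob_svd_same.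
have -> : \sum_j t 0 j ^+ 2 = frob_inner Y Y by rewrite frob_svd_same.
rewrite frobZl !frobDr !frobDl !frobNr !frobNl (frobC X Y); ring.
Qed.

(** Both sides decompose over the same weights, so the scalar comparison of the
    potential with the square is inherited by the matrices. *)
Lemma svd_bregman_ent_le (R : realType) (m n d : nat) (b : R)
    (P : 'M[R]_(m, d)) (s : 'rV[R]_d) (Q : 'M[R]_(n, d))
    (U : 'M[R]_(m, d)) (t : 'rV[R]_d) (V : 'M[R]_(n, d)) :
  0 < b -> (forall i, 0 <= t 0 i) ->
  U^T *m U = 1%:M -> V^T *m V = 1%:M -> P^T *m P = 1%:M -> Q^T *m Q = 1%:M ->
  let Z := P *m diag_mx s *m Q^T - U *m diag_mx t *m V^T in
  svd_bregman (ent b) (ent_deriv b) P s Q U t V <= frob_inner Z Z / b.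
Proof.
move=> b0 t0 UU VV PP QQ /=; rewrite frob_svd_sub//.
rewrite !svd_bregman_decomp//; first last.
- exact: ent_deriv0.
- exact: ent0.
- exact: entN.
- by rewrite mulr0.
- by rewrite expr0n.
- by move=> v; rewrite sqrrN.
have sq (x y : R) : scalar_bregman (fun v => v ^+ 2) (fun v => 2 * v) x y = (x - y) ^+ 2.
  by rewrite /scalar_bregman; ring.
have le x y : 0 <= y -> scalar_bregman (ent b) (ent_deriv b) x y
    <= scalar_bregman (fun v => v ^+ 2) (fun v => 2 * v) x y / b.
  by move=> y0; rewrite sq; exact: bregman_ent_le.
rewrite !mulrDl !mulr_suml !lerD//; apply: ler_sum => i _.
- rewrite mulr_suml; apply: ler_sum => j _; 
  move: (weight_plus_ge0 U P V Q i j) (weight_minus_ge0 U P V Q i j).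
  move: (weight_plus U P V Q i j) (weight_minus U P V Q i j) => wp wm wp0 wm0.
  by rewrite mulrDl -!mulrA; apply: lerD; apply: ler_wpM2l; rewrite ?le.
- by rewrite -mulrA; apply: ler_wpM2l; rewrite ?le ?weight_col_le1.
- by rewrite -mulrA; apply: ler_wpM2l; rewrite ?le ?weight_row_le1.
Qed.

Lemma weighted_amgm (R : realType) (l q x y : R) : 0 < l -> 0 < q ->
  x * y <= l * (x ^+ 2 / (2 * q)) + q * y ^+ 2 / (2 * l).
Proof.
move=> l0 q0; rewrite -subr_ge0.
have -> : l * (x ^+ 2 / (2 * q)) + q * y ^+ 2 / (2 * l) - x * y
    = (l * x - q * y) ^+ 2 / (2 * l * q).
  by field; rewrite !gt_eqF.
by rewrite divr_ge0 ?sqr_ge0// !mulr_ge0// ltW.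
Qed.

(** [weighted_amgm] for a factor [y] of size [2 * c * sqrt r], where [r] is the
    weight missing from a row or a column. *)
Lemma residual_amgm (R : realType) (l q x y c r : R) :
  0 < l -> 0 < q -> 0 <= x -> 0 <= c -> 0 <= r -> y ^+ 2 <= 4 * c ^+ 2 * r ->
  x * y <= l * (r * (x ^+ 2 / (2 * q))) + 2 * c ^+ 2 * q / l.
Proof.
move=> l0 q0 x0 c0 r0 h.
have hy : y <= 2 * c * Num.sqrt r.
  have [y0|y0] := leP 0 y; last first.
    by apply: (le_trans (ltW y0)); rewrite !mulr_ge0// sqrtr_ge0.
  rewrite -(@ler_pXn2r _ 2)// ?nnegrE//; last by rewrite !mulr_ge0// sqrtr_ge0.
  by rewrite exprMn sqr_sqrtr// exprMn; move: h; congr (_ <= _); ring.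
apply: le_trans (ler_wpM2l x0 hy) _.
have := @weighted_amgm R l q (x * Num.sqrt r) (2 * c) l0 q0.
rewrite !exprMn sqr_sqrtr//.
have -> : x * Num.sqrt r * (2 * c) = x * (2 * c * Num.sqrt r) by ring.
have -> : q * (2 ^+ 2 * c ^+ 2) / (2 * l) = 2 * c ^+ 2 * q / l by field; rewrite gt_eqF.
have -> // : x ^+ 2 * r / (2 * q) = r * (x ^+ 2 / (2 * q)) by field; rewrite gt_eqF.
Qed.

Lemma mulmx_col_entry (R : realType) (m d p : nat) (A : 'M[R]_(m, d)) (B : 'M[R]_(d, p)) i j :
  (A *m B) i j = (A *m col j B) i 0.
Proof. by rewrite colE mulmxA -colE [RHS]mxE. Qed.

Lemma frob_proj (R : realType) (m d : nat) (U : 'M[R]_(m, d)) (x y : 'cV[R]_m) :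
  \sum_i (U^T *m x) i 0 * (U^T *m y) i 0 = frob_inner (U *m (U^T *m x)) y.
Proof. by rewrite frob_mull; apply: eq_bigr => i _; rewrite big_ord1. Qed.

(** [2 p^T W q] is recovered from the projections of [p] on the columns of [U]
    and of [q] on those of [V], up to what these projections lose; that loss is
    measured by the weight missing from the corresponding column. *)
Lemma pairing_residual (R : realType) (m n d : nat) (c : R) (W : 'M[R]_(m, n))
    (P U : 'M[R]_(m, d)) (Q V : 'M[R]_(n, d)) (j : 'I_d) :
  op_le c W ->
  U^T *m U = 1%:M -> V^T *m V = 1%:M -> P^T *m P = 1%:M -> Q^T *m Q = 1%:M ->
  (2 * (P^T *m W *m Q) j j
   - \sum_i ((U^T *m P) i j * (U^T *m W *m Q) i j
           + (V^T *m Q) i j * (P^T *m W *m V) j i)) ^+ 2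
  <= 4 * c ^+ 2 * (1 - \sum_i weight U P V Q i j).
Proof.
move=> hW UU VV PP QQ.
pose p := col j P; pose q := col j Q.
have e1 : (P^T *m W *m Q) j j = frob_inner p (W *m q).
  rewrite mulmx_col_entry -mulmxA mxE; apply: eq_bigr => i _.
  by rewrite big_ord1 !mxE.
have e2 : \sum_i (U^T *m P) i j * (U^T *m W *m Q) i j
    = frob_inner (U *m (U^T *m p)) (W *m q).
  rewrite -frob_proj; apply: eq_bigr => i _.
  by rewrite mulmx_col_entry [in X in _ * X]mulmx_col_entry -mulmxA.
have e3 : \sum_i (V^T *m Q) i j * (P^T *m W *m V) j i
    = frob_inner (V *m (V^T *m q)) (W^T *m p).
  rewrite -frob_proj; apply: eq_bigr => i _; rewrite mulmx_col_entry.
  rewrite (_ : (P^T *m W *m V) j i = (V^T *m W^T *m P) i j).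
    by rewrite [in X in _ * X]mulmx_col_entry -mulmxA.
  rewrite (_ : V^T *m W^T *m P = (P^T *m W *m V)^T) 1?[RHS]mxE//.
  by rewrite !trmx_mul trmxK mulmxA.
rewrite big_split/= e1 e2 e3 weight_residualE -!orth_residual// -/p -/q.
set p' := p - _; set q' := q - _.
have -> : 2 * frob_inner p (W *m q)
    - (frob_inner (U *m (U^T *m p)) (W *m q) + frob_inner (V *m (V^T *m q)) (W^T *m p))
    = frob_inner p' (W *m q) + frob_inner q' (W^T *m p).
  have e4 : frob_inner q (W^T *m p) = frob_inner p (W *m q).
    by rewrite frobC frob_mull trmxK.
  rewrite /p' /q' !frobDl !frobNl e4; ring.
have h1 : frob_inner p' (W *m q) ^+ 2 <= c ^+ 2 * frob_inner p' p'.
  apply: le_trans (frob_CS _ _) _; rewrite mulrC ler_wpM2r ?frob_ge0//.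
  by apply: le_trans (hW _) _; rewrite frob_orth_col// mulr1.
have h2 : frob_inner q' (W^T *m p) ^+ 2 <= c ^+ 2 * frob_inner q' q'.
  apply: le_trans (frob_CS _ _) _; rewrite mulrC ler_wpM2r ?frob_ge0//.
  by apply: le_trans (op_le_tr hW _) _; rewrite frob_orth_col// mulr1.
by have := sqr_ge0 (frob_inner p' (W *m q) - frob_inner q' (W^T *m p)); nra.
Qed.

Lemma frob_pair_svd (R : realType) (m n d : nat) (W : 'M[R]_(m, n))
    (P : 'M[R]_(m, d)) (s : 'rV[R]_d) (Q : 'M[R]_(n, d)) :
  frob_inner W (P *m diag_mx s *m Q^T)
  = \sum_j s 0 j * (P^T *m W *m Q) j j.
Proof.
by rewrite frobC -mulmxA frob_mull frob_mulr trmxK frob_diag.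
Qed.

(** The difference of the two matrices, seen through the two singular bases,
    has coefficients [s - t] on the part where the bases agree and [s + t] on
    the part where they are opposite: exactly the differences whose squares
    bound the scalar divergences from below.  An arithmetic-geometric mean in
    every coordinate then trades the pairing for the divergence, and the
    conjugate terms add up to the nuclear norms because [W] has operator norm
    at most [c]. *)
Lemma pairing_le_svd_bregman (R : realType) (m n d : nat) (b c l : R)
    (W : 'M[R]_(m, n))
    (P : 'M[R]_(m, d)) (s : 'rV[R]_d) (Q : 'M[R]_(n, d))
    (U : 'M[R]_(m, d)) (t : 'rV[R]_d) (V : 'M[R]_(n, d)) :
  0 < b -> 0 < l -> 0 <= c -> op_le c W ->
  (forall i, 0 <= s 0 i) -> (forall i, 0 <= t 0 i) ->
  U^T *m U = 1%:M -> V^T *m V = 1%:M -> P^T *m P = 1%:M -> Q^T *m Q = 1%:M ->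
  2 * frob_inner W (P *m diag_mx s *m Q^T - U *m diag_mx t *m V^T)
  <= l * svd_bregman (ent b) (ent_deriv b) P s Q U t V
     + 4 * c ^+ 2 / l * (\sum_j s 0 j + \sum_i t 0 i + 3 * (d%:R * b)).
Proof.
move=> b0 l0 c0 hW s0 t0 UU VV PP QQ.
rewrite svd_bregman_decomp//; [|exact: entN|exact: ent0|exact: ent_deriv0].
set BR := scalar_bregman _ _; set w := weight U P V Q.
(* The two mixed matrices [E] and [F] express [W] in one singular vector of each
   decomposition; [rho] and [rho'] are the parts of [2 <W, X>] and [2 <W, Y>] that
   they miss. *)
pose E i j := (P^T *m W *m V) j i; pose F := U^T *m W *m Q.
pose A := U^T *m P; pose C := V^T *m Q.
pose rho j := 2 * (P^T *m W *m Q) j j - \sum_i (A i j * F i j + C i j * E i j).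
pose rho' i := 2 * (U^T *m W *m V) i i - \sum_j (A i j * E i j + C i j * F i j).
pose q i j := s 0 j + t 0 i + 2 * b.
(* The cross terms regroup into [s - t] against [A + C] and [- s - t] against
   [A - C], the same pairs as in the decomposition of the divergence. *)
have splitW : 2 * frob_inner W (P *m diag_mx s *m Q^T - U *m diag_mx t *m V^T)
    = \sum_i \sum_j ((s 0 j - t 0 i) * ((A i j + C i j) / 2) * (E i j + F i j)
                    + (- s 0 j - t 0 i) * ((A i j - C i j) / 2) * (E i j - F i j))
      + \sum_j s 0 j * rho j + \sum_i t 0 i * - rho' i.
  rewrite frobDr frobNr !frob_pair_svd.
  have -> : \sum_j s 0 j * rho j = 2 * \sum_j s 0 j * (P^T *m W *m Q) j j
      - \sum_i \sum_j s 0 j * (A i j * F i j + C i j * E i j).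
    rewrite exchange_big/= mulr_sumr -sumrB; apply: eq_bigr => j _.
    by rewrite /rho -mulr_sumr; ring.
  have -> : \sum_i t 0 i * - rho' i = - (2 * \sum_i t 0 i * (U^T *m W *m V) i i)
      + \sum_i \sum_j t 0 i * (A i j * E i j + C i j * F i j).
    rewrite mulr_sumr -sumrN -big_split; apply: eq_bigr => i _.
    by rewrite /rho' -mulr_sumr/=; ring.
  have -> : \sum_i \sum_j ((s 0 j - t 0 i) * ((A i j + C i j) / 2) * (E i j + F i j)
                    + (- s 0 j - t 0 i) * ((A i j - C i j) / 2) * (E i j - F i j))
      = \sum_i \sum_j s 0 j * (A i j * F i j + C i j * E i j)
        - \sum_i \sum_j t 0 i * (A i j * E i j + C i j * F i j).
    rewrite -sumrB; apply: eq_bigr => i _; rewrite -sumrB; apply: eq_bigr => j _.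
    by field.
  ring.
have main i j : (s 0 j - t 0 i) * ((A i j + C i j) / 2) * (E i j + F i j)
      + (- s 0 j - t 0 i) * ((A i j - C i j) / 2) * (E i j - F i j)
    <= l * (weight_plus U P V Q i j * BR (s 0 j) (t 0 i)
            + weight_minus U P V Q i j * BR (- s 0 j) (t 0 i))
       + q i j * (E i j ^+ 2 + F i j ^+ 2) / l.
  have q0 : 0 < q i j by have := s0 j; have := t0 i; rewrite /q; lra.
  have half x a y z : z ^+ 2 / (2 * q i j) <= x ->
      z * a * y <= l * (a ^+ 2 * x) + q i j * y ^+ 2 / (2 * l).
    move=> hx; apply: le_trans (weighted_amgm _ _ l0 q0) _.
    rewrite lerD2r ler_pM2l// exprMn mulrAC [leLHS]mulrC.
    by apply: ler_wpM2l; rewrite ?sqr_ge0. 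
  have g1 := bregman_ent_ge (s 0 j) b0 (t0 i).
  have g2 := bregman_ent_ge (- s 0 j) b0 (t0 i).
  rewrite ?normrN (ger0_norm (s0 j)) -/(q i j) in g1 g2.
  have b1 := half _ ((A i j + C i j) / 2) (E i j + F i j) _ g1.
  have b2 := half _ ((A i j - C i j) / 2) (E i j - F i j) _ g2.
  apply: le_trans (lerD b1 b2) _.
  rewrite le_eqVlt; apply/orP; left; apply/eqP.
  rewrite /weight_plus /weight_minus -/A -/C /BR.
  by field; rewrite gt_eqF.
have res x y r : 0 <= x -> 0 <= r -> y ^+ 2 <= 4 * c ^+ 2 * r ->
    x * y <= l * (r * BR x 0) + 2 * c ^+ 2 * (x + 2 * b) / l.
  move=> x0 r0 hy; have xb : 0 < x + 2 * b by lra.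
  apply: le_trans (residual_amgm l0 xb x0 c0 r0 hy) _.
  rewrite lerD2r ler_pM2l// ler_wpM2l//.
  by have := bregman_ent_ge x b0 (lexx 0); rewrite subr0 addr0 ger0_norm.
have res' x y r : 0 <= x -> 0 <= r -> y ^+ 2 <= 4 * c ^+ 2 * r ->
    x * y <= l * (r * BR 0 x) + 2 * c ^+ 2 * (x + 2 * b) / l.
  move=> x0 r0 hy; have xb : 0 < x + 2 * b by lra.
  apply: le_trans (residual_amgm l0 xb x0 c0 r0 hy) _.
  rewrite lerD2r ler_pM2l// ler_wpM2l//.
  by have := bregman_ent_ge 0 b0 x0; rewrite sub0r sqrrN normr0 add0r.
have rP j : s 0 j * rho j <= l * ((1 - \sum_i w i j) * BR (s 0 j) 0)
    + 2 * c ^+ 2 * (s 0 j + 2 * b) / l.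
  by apply: res => //; [exact: weight_col_le1|exact: pairing_residual].
have rU i : t 0 i * - rho' i <= l * ((1 - \sum_j w i j) * BR 0 (t 0 i))
    + 2 * c ^+ 2 * (t 0 i + 2 * b) / l.
  apply: res' => //; first exact: weight_row_le1.
  rewrite sqrrN; have := pairing_residual i hW PP QQ UU VV.
  have -> : \sum_j weight P U Q V j i = \sum_j w i j.
    by apply: eq_bigr => j _; exact: weightC.
  congr (is_true (_ ^+ 2 <= _)); congr (_ - _); apply: eq_bigr => j _.
  by rewrite !(mulmx_tr_swap _ _ i j).
(* Bessel: rows and columns of [E] and [F] have squared norm at most [c ^+ 2]. *)
have sumE : \sum_i \sum_j q i j * (E i j ^+ 2 + F i j ^+ 2)
    <= 2 * c ^+ 2 * (\sum_j s 0 j + \sum_i t 0 i + 2 * (d%:R * b)).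
  have -> : \sum_i \sum_j q i j * (E i j ^+ 2 + F i j ^+ 2)
      = \sum_j (s 0 j + 2 * b) * (\sum_i E i j ^+ 2 + \sum_i F i j ^+ 2)
        + \sum_i t 0 i * (\sum_j E i j ^+ 2 + \sum_j F i j ^+ 2).
    have -> : \sum_j (s 0 j + 2 * b) * (\sum_i E i j ^+ 2 + \sum_i F i j ^+ 2)
        = \sum_i \sum_j (s 0 j + 2 * b) * (E i j ^+ 2 + F i j ^+ 2).
      rewrite [RHS]exchange_big; apply: eq_bigr => j _.
      by rewrite -mulr_sumr big_split.
    rewrite -big_split; apply: eq_bigr => i _ /=.
    rewrite -big_split mulr_sumr -big_split; apply: eq_bigr => j _ /=.
    by rewrite /q; ring.
  have h1 j : (s 0 j + 2 * b) * (\sum_i E i j ^+ 2 + \sum_i F i j ^+ 2)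
      <= 2 * c ^+ 2 * (s 0 j + 2 * b).
    rewrite mulrC ler_wpM2r//; first by have := s0 j; lra.
    have := op_le_row j hW PP VV; have := op_le_col j hW UU QQ.
    by rewrite -/F; rewrite /E; lra.
  have h2 i : t 0 i * (\sum_j E i j ^+ 2 + \sum_j F i j ^+ 2) <= 2 * c ^+ 2 * t 0 i.
    rewrite mulrC ler_wpM2r//.
    have := op_le_col i hW PP VV; have := op_le_row i hW UU QQ.
    by rewrite -/F; rewrite /E; lra.
  apply: (@le_trans _ _ (\sum_j 2 * c ^+ 2 * (s 0 j + 2 * b) + \sum_i 2 * c ^+ 2 * t 0 i)).
    by apply: lerD; apply: ler_sum => k _.
  rewrite -!mulr_sumr big_split/= sumr_const card_ord -mulr_natl.
  by rewrite le_eqVlt; apply/orP; left; apply/eqP; ring.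
have S1 := ler_sum (index_enum 'I_d) (fun i (_ : true) =>
  ler_sum (index_enum 'I_d) (fun j (_ : true) => main i j)).
have S2 := ler_sum (index_enum 'I_d) (fun j (_ : true) => rP j).
have S3 := ler_sum (index_enum 'I_d) (fun i (_ : true) => rU i).
rewrite splitW; apply: le_trans (lerD (lerD S1 S2) S3) _.
have -> : \sum_i \sum_j (l * (weight_plus U P V Q i j * BR (s 0 j) (t 0 i)
            + weight_minus U P V Q i j * BR (- s 0 j) (t 0 i))
       + q i j * (E i j ^+ 2 + F i j ^+ 2) / l)
   = l * (\sum_i \sum_j (weight_plus U P V Q i j * BR (s 0 j) (t 0 i)
            + weight_minus U P V Q i j * BR (- s 0 j) (t 0 i)))
     + (\sum_i \sum_j q i j * (E i j ^+ 2 + F i j ^+ 2)) / l.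
  rewrite mulr_sumr mulr_suml -big_split; apply: eq_bigr => i _ /=.
  by rewrite mulr_sumr mulr_suml -big_split.
have sumS (f g : 'I_d -> R) :
    \sum_i (l * g i + 2 * c ^+ 2 * (f i + 2 * b) / l)
    = l * (\sum_i g i) + 2 * c ^+ 2 * (\sum_i f i + 2 * (d%:R * b)) / l.
  rewrite big_split/= -mulr_sumr -mulr_suml -mulr_sumr big_split/=.
  by rewrite sumr_const card_ord -[_ *+ d]mulr_natl [d%:R * _]mulrCA.
rewrite !sumS.
have K := ler_wpM2r (ltW (etrans (invr_gt0 l) l0)) sumE.
apply: (@le_trans _ _ (l * (\sum_i \sum_j (weight_plus U P V Q i j * BR (s 0 j) (t 0 i)
            + weight_minus U P V Q i j * BR (- s 0 j) (t 0 i)))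
   + 2 * c ^+ 2 * (\sum_j s 0 j + \sum_i t 0 i + 2 * (d%:R * b)) / l
   + (l * (\sum_j (1 - \sum_i w i j) * BR (s 0 j) 0)
      + 2 * c ^+ 2 * (\sum_j s 0 j + 2 * (d%:R * b)) / l)
   + (l * (\sum_i (1 - \sum_j w i j) * BR 0 (t 0 i))
      + 2 * c ^+ 2 * (\sum_i t 0 i + 2 * (d%:R * b)) / l))).
  by rewrite !lerD2r lerD2l.
by rewrite le_eqVlt; apply/orP; left; apply/eqP; field; rewrite gt_eqF.
Qed.

(** * Differentiability of the regulariser *)

(** A quadratic remainder makes the difference quotient at [k] differ from [L]
    by at most [M * |k|]. *)
Lemma derive_quadratic (R : realType) (m n : nat) (F : 'M[R]_(m, n) -> R)
    (y v : 'M[R]_(m, n)) (L M : R) :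
  (forall k : R, `|F (k *: v + y) - F y - k * L| <= M * k ^+ 2) ->
  'D_v F y = L.
Proof.
move=> H; have M0 : 0 <= M.
  by apply: le_trans (normr_ge0 _) _; have := H 1; rewrite expr1n mulr1; apply.
rewrite /derive; apply: cvg_lim => //.
apply/cvgrPdist_le => e e0.
have eM : 0 < e / (M + 1) by rewrite divr_gt0// ltr_wpDl.
near=> k.
have k0 : k != 0 by near: k; exact: nbhs_dnbhs_neq.
have ke : `|k| <= e / (M + 1) by near: k; exact: dnbhs0_le.
rewrite /= distrC.
have -> : k^-1 *: (F (k *: v + y) - F y) - L = k^-1 * (F (k *: v + y) - F y - k * L).
  by rewrite /GRing.scale/=; field.
rewrite normrM normfV ler_pdivrMl ?normr_gt0//.
apply: le_trans (H k) _; rewrite -real_normK ?num_real// expr2 mulrA [leRHS]mulrC.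
rewrite ler_wpM2r//; apply: le_trans (ler_wpM2l M0 ke) _.
rewrite mulrA ler_pdivrMr; last by lra.
by nra.
Unshelve. all: by end_near.
Qed.

Lemma svdP (R : realType) (m n : nat) (x : 'M[R]_(m, n)) :
  exists (U : 'M[R]_(m, minn m n)) (V : 'M[R]_(n, minn m n)),
    [/\ U^T *m U = 1%:M, V^T *m V = 1%:M &
        x = U *m diag_mx (singular_values x) *m V^T].
Proof. by have [_ _ h] := singular_valuesP x. Qed.

Lemma singular_values_ge0 (R : realType) (m n : nat) (x : 'M[R]_(m, n)) i :
  0 <= singular_values x 0 i.
Proof. by have [h _ _] := singular_valuesP x. Qed.

Lemma PhiE (R : realType) (m n : nat) (a b : R) (x : 'M[R]_(m, n)) :
  Phi a b x = a * \sum_i ent b (singular_values x 0 i).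
Proof. by []. Qed.

(** [svd_bregman] lies between 0 and a multiple of the squared Frobenius
    distance, so the spectral gradient is the derivative in every direction. *)
Lemma gradient_Phi (R : realType) (m n : nat) (a b : R) (y : 'M[R]_(m, n))
    (U : 'M[R]_(m, minn m n)) (V : 'M[R]_(n, minn m n)) :
  0 < b -> U^T *m U = 1%:M -> V^T *m V = 1%:M ->
  y = U *m diag_mx (singular_values y) *m V^T ->
  gradient (Phi a b) y
  = a *: spectral_gradient (ent_deriv b) U (singular_values y) V.
Proof.
move=> b0 UU VV yE; set G := spectral_gradient _ _ _ _.
apply/matrixP => i j; rewrite [LHS]mxE [RHS]mxE -frob_delta.
set v := delta_mx i j.
apply: (@derive_quadratic _ _ _ _ _ _ _ (`|a| * (frob_inner v v / b))) => k.
pose z := k *: v + y.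
have [P [Q [PP QQ zE]]] := svdP z.
have zy : z - y = k *: v by rewrite /z addrK.
have t0 := singular_values_ge0 y.
have := svd_bregman_ent_ge0 (singular_values z) b0 t0 UU VV PP QQ.
have := svd_bregman_ent_le (singular_values z) b0 t0 UU VV PP QQ.
rewrite /= /svd_bregman -zE -yE zy -/G frobZr !frobZl frobZr !PhiE -/z => h1 h2.
have -> : a * \sum_i ent b (singular_values z 0 i)
    - a * \sum_i ent b (singular_values y 0 i) - k * (a * frob_inner G v)
  = a * (\sum_i ent b (singular_values z 0 i)
      - \sum_i ent b (singular_values y 0 i) - k * frob_inner G v) by ring.
rewrite normrM -mulrA ler_wpM2l// ger0_norm//; apply: le_trans h1 _.
by rewrite le_eqVlt; apply/orP; left; apply/eqP; field; rewrite gt_eqF.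
Qed.

Lemma bregman_Phi (R : realType) (m n : nat) (a b : R) (x y : 'M[R]_(m, n))
    (P U : 'M[R]_(m, minn m n)) (Q V : 'M[R]_(n, minn m n)) :
  0 < b ->
  U^T *m U = 1%:M -> V^T *m V = 1%:M ->
  y = U *m diag_mx (singular_values y) *m V^T ->
  x = P *m diag_mx (singular_values x) *m Q^T ->
  bregman (Phi a b) x y
  = a * svd_bregman (ent b) (ent_deriv b) P (singular_values x) Q U (singular_values y) V.
Proof.
move=> b0 UU VV yE xE; rewrite /bregman (gradient_Phi a b0 UU VV yE) frobZl !PhiE.
rewrite /svd_bregman -xE -yE; ring.
Qed.

Lemma bregman_Phi_scale (R : realType) (m n : nat) (a b : R) (x y : 'M[R]_(m, n)) :
  0 < b -> bregman (Phi a b) x y = a * bregman (Phi 1 b) x y.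
Proof.
move=> b0; have [U [V [UU VV yE]]] := svdP y; have [P [Q [PP QQ xE]]] := svdP x.
by rewrite !(bregman_Phi _ b0 UU VV yE xE) mul1r.
Qed.

Lemma bregman_Phi_ge0 (R : realType) (m n : nat) (b : R) (x y : 'M[R]_(m, n)) :
  0 < b -> 0 <= bregman (Phi 1 b) x y.
Proof.
move=> b0; have [U [V [UU VV yE]]] := svdP y; have [P [Q [PP QQ xE]]] := svdP x.
rewrite (bregman_Phi _ b0 UU VV yE xE) mul1r svd_bregman_ent_ge0//.
exact: singular_values_ge0.
Qed.

Lemma bregman_Phi_le (R : realType) (m n : nat) (b : R) (x y : 'M[R]_(m, n)) :
  0 < b -> bregman (Phi 1 b) x y <= frob_inner (x - y) (x - y) / b.
Proof.
move=> b0; have [U [V [UU VV yE]]] := svdP y; have [P [Q [PP QQ xE]]] := svdP x.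
rewrite (bregman_Phi _ b0 UU VV yE xE) mul1r.
rewrite [in leRHS]yE [in leRHS]xE; apply: svd_bregman_ent_le => //.
exact: singular_values_ge0.
Qed.

Lemma pairing_le_bregman (R : realType) (m n : nat) (a b c D : R)
    (W x y : 'M[R]_(m, n)) :
  0 < a -> 0 < b -> (minn m n)%:R * b = 1 -> 0 <= c -> op_le c W ->
  nuclear_norm x <= D -> nuclear_norm y <= D ->
  frob_inner W (x - y) <= bregman (Phi a b) x y + c ^+ 2 * (2 * D + 3) / a.
Proof.
move=> a0 b0 db c0 hW xD yD.
have [U [V [UU VV yE]]] := svdP y; have [P [Q [PP QQ xE]]] := svdP x.
rewrite (bregman_Phi _ b0 UU VV yE xE).
(* The factor 2 cancels the one in front of the pairing. *)
have l0 : 0 < 2 * a by lra.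
have := pairing_le_svd_bregman b0 l0 c0 hW (@singular_values_ge0 _ _ _ x)
  (@singular_values_ge0 _ _ _ y) UU VV PP QQ.
rewrite -xE -yE db; set B := svd_bregman _ _ _ _ _ _ _ _ => h.
have k : 4 * c ^+ 2 / (2 * a) * (\sum_j singular_values x 0 j + \sum_j singular_values y 0 j + 3 * 1)
    <= 4 * c ^+ 2 / (2 * a) * (2 * D + 3).
  rewrite ler_wpM2l//; first by rewrite divr_ge0 ?mulr_ge0 ?sqr_ge0// ltW.
  by move: xD yD; rewrite /nuclear_norm; lra.
have e : 4 * c ^+ 2 / (2 * a) * (2 * D + 3) = 2 * (c ^+ 2 * (2 * D + 3) / a).
  by field; rewrite gt_eqF.
by lra.
Qed.

(** Each diagonal entry of [P^T W Q] is at most [c] in absolute value. *)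
Lemma holder_nuclear (R : realType) (m n : nat) (c : R) (W x : 'M[R]_(m, n)) :
  0 <= c -> op_le c W -> `|frob_inner W x| <= c * nuclear_norm x.
Proof.
move=> c0 hW; have [P [Q [PP QQ xE]]] := svdP x.
rewrite [in leLHS]xE frob_pair_svd mulr_sumr.
apply: le_trans (ler_norm_sum _ _ _) _; apply: ler_sum => j _.
rewrite normrM ger0_norm ?singular_values_ge0// mulrC ler_wpM2r ?singular_values_ge0//.
rewrite -(@ler_pXn2r _ 2)// ?nnegrE// real_normK ?num_real//.
apply: le_trans (op_le_col j hW PP QQ).
by rewrite (bigD1 j)//= lerDl sumr_ge0// => i _; rewrite sqr_ge0.
Qed.

(** The potential at [x] is at most [(D + 1) * L], the potential at [y] is
    nonnegative, and the gradient at [y] has spectral norm at most [L], so its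
    pairing with [x - y] costs at most [2 * D * L]. *)
Lemma bregman_Phi_diameter (R : realType) (m n : nat) (b D L : R) (x y : 'M[R]_(m, n)) :
  0 < b -> (minn m n)%:R * b = 1 -> 0 <= L -> ln (D / b + 1) <= L ->
  nuclear_norm x <= D -> nuclear_norm y <= D ->
  bregman (Phi 1 b) x y <= (3 * D + 1) * L.
Proof.
move=> b0 db L0 hL xD yD.
have svle (z : 'M[R]_(m, n)) i : nuclear_norm z <= D -> ln (singular_values z 0 i / b + 1) <= L.
  move=> zD; apply: le_trans hL.
  have z0 := singular_values_ge0 z.
  have zi : singular_values z 0 i <= D.
    apply: le_trans zD; rewrite /nuclear_norm (bigD1 i)//= lerDl.
    by rewrite sumr_ge0.
  have ib : 0 < b^-1 by rewrite invr_gt0.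
  have zb : 0 <= singular_values z 0 i / b by rewrite divr_ge0// ltW.
  have zb' : singular_values z 0 i / b <= D / b by rewrite ler_pM2r.
  by rewrite ler_ln ?posrE; lra.
have [U [V [UU VV yE]]] := svdP y.
pose G := spectral_gradient (ent_deriv b) U (singular_values y) V.
have hG : op_le L G.
  apply: op_le_svd => // i; rewrite mxE ent_deriv_nonneg ?singular_values_ge0//.
  rewrite ger0_norm ?svle// ln_ge0// lerDr divr_ge0 ?singular_values_ge0//.
  exact: ltW.
rewrite /bregman (gradient_Phi 1 b0 UU VV yE) scale1r -/G !PhiE !mul1r frobBr.
have gx := holder_nuclear x L0 hG; have gy := holder_nuclear y L0 hG.
rewrite ler_norml in gx; rewrite ler_norml in gy.
have gx' := ler_wpM2l L0 xD; have gy' := ler_wpM2l L0 yD.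
have fy : 0 <= \sum_i ent b (singular_values y 0 i).
  apply: sumr_ge0 => i _.
  have := bregman_ent_ge0 (singular_values y 0 i) b0 (lexx 0).
  by rewrite /scalar_bregman ent0 ent_deriv0 mul0r !subr0.
have fx : \sum_i ent b (singular_values x 0 i) <= (D + 1) * L.
  apply: (@le_trans _ _ (\sum_i (singular_values x 0 i + b) * L)).
    apply: ler_sum => i _; have x0 := singular_values_ge0 x i.
    rewrite /ent !ger0_norm// lerBlDr ler_wpDr//.
    by rewrite ler_wpM2l ?svle// addr_ge0// ltW.
  rewrite -mulr_suml ler_wpM2r// big_split/= sumr_const card_ord.
  by rewrite -mulr_natl db lerD2r.
by move: gx gy => /andP[? ?] /andP[? ?]; lra.
Qed.

(** * The mirror step *)

Lemma segmentE (R : pzRingType) (V : lmodType R) (x u : V) (k : R) :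
  k *: u + (1 - k) *: x = x + k *: (u - x).
Proof. by rewrite scalerBl scale1r scalerBr addrCA. Qed.

Lemma convex_set_segment (R : realType) (m n : nat) (K : set 'M[R]_(m, n)) x u (k : R) :
  convex_set K -> K x -> K u -> 0 <= k -> k <= 1 -> K (x + k *: (u - x)).
Proof.
move=> cK Kx Ku k0 k1.
have := cK u x (Itv01 k0 k1) (mem_set Ku) (mem_set Kx).
by move=> /set_mem; rewrite -segmentE.
Qed.

Lemma convex_function_segment (R : realType) (m n : nat) (r : 'M[R]_(m, n) -> R) x u (k : R) :
  convex_function setT r -> 0 <= k -> k <= 1 ->
  r (x + k *: (u - x)) <= r x + k * (r u - r x).
Proof.
move=> cr k0 k1; rewrite -segmentE -[leRHS](segmentE (V := R^o)).
exact: cr (Itv01 k0 k1) u x (mem_set I) (mem_set I).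
Qed.

(** Letting [k] tend to 0; the witness in the proof makes [k * |q|] smaller than
    [- p]. *)
Lemma ge0_of_affine_ge0 (R : realType) (p q : R) :
  (forall k, 0 < k -> k <= 1 -> 0 <= p + k * q) -> 0 <= p.
Proof.
move=> h; rewrite leNgt; apply/negP => p0.
have q1 : 0 < 1 + `|q| - p by have := normr_ge0 q; lra.
pose k := - p / (2 * (1 + `|q| - p)).
have k0 : 0 < k by rewrite divr_gt0//; lra.
have kE : k * (1 + `|q| - p) = - p / 2.
  by rewrite /k; field; rewrite gt_eqF.
have k1 : k <= 1 by rewrite ler_pdivrMr; have := normr_ge0 q; lra.
have := h k k0 k1; have qn := ler_wpM2l (ltW k0) (ler_norm q).
by nra.
Qed.

(** First-order optimality along the segment from the minimiser [x'] to [u]: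
    the divergence contributes at second order only, since it is at most a
    multiple of the squared Frobenius distance. *)
Lemma mirror_step (R : realType) (m n : nat) (K : set 'M[R]_(m, n)) (a b : R)
    (r : 'M[R]_(m, n) -> R) (w y x' u : 'M[R]_(m, n)) :
  0 < b -> 0 <= a -> convex_set K -> convex_function setT r -> K u ->
  argmins K (fun z => frob_inner w z + r z + bregman (Phi a b) z y) x' ->
  frob_inner w (x' - u) + r x' - r u
  <= bregman (Phi a b) u y - bregman (Phi a b) u x' - bregman (Phi a b) x' y.
Proof.
move=> b0 a0 cK cr Ku [Kx' xmin].
rewrite -subr_ge0; set d := u - x'.
have -> : x' - u = - d by rewrite opprB.
apply: (@ge0_of_affine_ge0 _ _ (a * (frob_inner d d / b))) => k k0 k1.
pose z := x' + k *: d.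
have Kz : K z by apply: convex_set_segment => //; exact: ltW.
have hr : r z <= r x' + k * (r u - r x').
  by apply: convex_function_segment => //; exact: ltW.
have hz := xmin z Kz.
have zd : z - x' = k *: d by rewrite /z addrC addKr.
have hB : bregman (Phi a b) z x' <= a * (k ^+ 2 * frob_inner d d / b).
  rewrite bregman_Phi_scale// ler_wpM2l//; apply: le_trans (bregman_Phi_le _ _ b0) _.
  by rewrite zd frobZl frobZr mulrA -expr2.
(* The three-point identity. *)
have three : bregman (Phi a b) u y - bregman (Phi a b) u x' - bregman (Phi a b) x' y
    = frob_inner (gradient (Phi a b) x') d - frob_inner (gradient (Phi a b) y) d.
  by rewrite /bregman /d !frobBr; ring.
have wz : frob_inner w z = frob_inner w x' + k * frob_inner w d.
  by rewrite /z frobDr frobZr.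
have yz : frob_inner (gradient (Phi a b) y) (z - y)
    = frob_inner (gradient (Phi a b) y) (x' - y) + k * frob_inner (gradient (Phi a b) y) d.
  by rewrite -frobZr -frobDr /z addrAC.
rewrite three frobNr -(ler_pM2l k0) mulr0.
move: hz hB; rewrite /bregman wz yz zd frobZr => hz hB.
have e : a * (k ^+ 2 * frob_inner d d / b) = k * (k * (a * (frob_inner d d / b))) by ring.
by rewrite e in hB; lra.
Qed.

(** * The regret bound *)

Lemma minn_ge1 (R : realType) (m n : nat) :
  (0 < m)%N -> (0 < n)%N -> 1 <= (minn m n)%:R :> R.
Proof. by move=> m0 n0; rewrite ler1n leq_min m0. Qed.

Lemma log_factor_ge (R : realType) (m n : nat) (D : R) :
  (0 < m)%N -> (0 < n)%N -> ln (D + 1) <= log_factor m n D.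
Proof. by move=> m0 n0; rewrite lerDl ln_ge0// minn_ge1. Qed.

Lemma log_factor_gt0 (R : realType) (m n : nat) (D : R) :
  (0 < m)%N -> (0 < n)%N -> 0 < D -> 0 < log_factor m n D.
Proof.
move=> m0 n0 D0; apply: lt_le_trans (log_factor_ge D m0 n0).
by rewrite ln_gt0//; lra.
Qed.

Lemma ln_dim_le_log_factor (R : realType) (m n : nat) (D : R) :
  (0 < m)%N -> (0 < n)%N -> 0 < D ->
  ln (D / beta R m n + 1) <= log_factor m n D.
Proof.
move=> m0 n0 D0; have d1 := minn_ge1 R m0 n0.
rewrite /log_factor /beta div1r invrK; move: d1; set d := (minn m n)%:R => d1.
have Dd : D * 1 <= D * d by rewrite ler_pM2l.
rewrite -lnM ?posrE; [|lra|lra].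
by rewrite ler_ln ?posrE; nra.
Qed.

Lemma beta_gt0 (R : realType) (m n : nat) :
  (0 < m)%N -> (0 < n)%N -> 0 < beta R m n.
Proof. by move=> m0 n0; rewrite divr_gt0//; have := minn_ge1 R m0 n0; lra. Qed.

Lemma dim_beta (R : realType) (m n : nat) :
  (0 < m)%N -> (0 < n)%N -> (minn m n)%:R * beta R m n = 1.
Proof.
move=> m0 n0; rewrite /beta div1r divff// gt_eqF//.
by have := minn_ge1 R m0 n0; lra.
Qed.

Lemma etaE (R : realType) (m n : nat) (D : R) :
  (0 < m)%N -> (0 < n)%N -> 0 < D -> eta m n D = (Num.sqrt (log_factor m n D))^-1.
Proof.
by move=> m0 n0 D0; rewrite /eta div1r sqrtrV// ltW// log_factor_gt0.
Qed.

(** With step size proportional to [S1], the stability term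
    [c ^+ 2 / S1 = (S1 ^+ 2 - S0 ^+ 2) / S1] is at most [2 * (S1 - S0)], which
    telescopes over the rounds. *)
Lemma stability (R : realType) (m n : nat) (b c D e S0 S1 : R)
    (W x y : 'M[R]_(m, n)) :
  0 < b -> (minn m n)%:R * b = 1 -> 0 < e -> 0 <= c -> 0 <= D ->
  0 <= S0 -> 0 <= S1 -> S1 ^+ 2 = S0 ^+ 2 + c ^+ 2 -> op_le c W ->
  nuclear_norm x <= D -> nuclear_norm y <= D ->
  frob_inner W (x - y)
  <= bregman (Phi (e^-1 * S1) b) x y + (4 * D + 6) * e * (S1 - S0).
Proof.
move=> b0 db e0 c0 D0 S00 S10 SE hW xD yD.
have S01 : S0 <= S1 by rewrite -(@ler_pXn2r _ 2)// SE lerDl sqr_ge0.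
have [S1p|S1p] := ltP 0 S1; last first.
  have S1z : S1 = 0 by apply/eqP; rewrite eq_le S1p.
  have S0z : S0 = 0 by apply/eqP; rewrite eq_le S00 -S1z S01.
  have cz : c = 0.
    by apply/eqP; rewrite -sqrf_eq0; move: SE; rewrite S1z S0z !expr0n add0r => <-.
  have := holder_nuclear (x - y) c0 hW; rewrite cz mul0r normr_le0 => /eqP ->.
  by rewrite bregman_Phi_scale// S1z S0z subrr !mulr0 mul0r addr0.
have a0 : 0 < e^-1 * S1 by rewrite mulr_gt0// invr_gt0.
apply: le_trans (pairing_le_bregman a0 b0 db c0 hW xD yD) _.
rewrite lerD2l ler_pdivrMr//.
have -> : (4 * D + 6) * e * (S1 - S0) * (e^-1 * S1) = (2 * D + 3) * (2 * (S1 - S0) * S1).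
  by field; rewrite gt_eqF.
rewrite mulrC ler_wpM2l//; first by lra.
have -> : c ^+ 2 = S1 ^+ 2 - S0 ^+ 2 by rewrite SE; ring.
by nra.
Qed.

(** The last round costs [2 * D], as no later decision can compensate its
    gradient error; the diameter of the divergence gives [3 * D + 1] and the
    stability terms [4 * D + 6]. *)
Definition regret_constant (R : realType) (m n : nat) (D : R) : R :=
  2 * D + (7 * D + 7) * Num.sqrt (log_factor m n D).

(** For [D0 <= D] the logarithmic factor is at least [ln (D0 + 1)] and [1] is at
    most [D / D0], which absorbs the lower-order terms. *)
Lemma regret_constant_bigO (R : realType) : constant_bigO (@regret_constant R).
Proof.
move=> D0 D0p; pose k := Num.sqrt (ln (D0 + 1)).
have k0 : 0 < k by rewrite sqrtr_gt0 ln_gt0//; lra.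
exists (2 / k + 7 + 7 / D0) => m n D m0 n0 DD0.
have Dp : 0 < D by lra.
have kL : k <= Num.sqrt (log_factor m n D).
  apply: ler_wsqrtr; apply: le_trans (log_factor_ge D m0 n0).
  by rewrite ler_ln ?posrE; lra.
rewrite /regret_constant; set s := Num.sqrt _ in kL *.
have s0 : 0 < s by apply: lt_le_trans kL.
rewrite ger0_norm; last by rewrite addr_ge0// mulr_ge0//; lra.
have h1 : 2 * D <= 2 / k * (D * s).
  have -> : 2 / k * (D * s) = (2 * D) * (s / k) by field; rewrite gt_eqF.
  by rewrite ler_peMr ?ler_pdivlMr ?mul1r//; lra.
have h2 : 7 * s <= 7 / D0 * (D * s).
  have -> : 7 / D0 * (D * s) = 7 * s * (D / D0) by field; rewrite gt_eqF.
  by rewrite ler_peMr ?ler_pdivlMr ?mul1r//; lra.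
by lra.
Qed.

(** The regret against [u], carried from round to round: the hint in use and
    the current divergence to [u] are kept on the left, so that one mirror step
    and the stability estimate close each round. *)
Lemma regret_prefix (R : realType) (m n : nat) (K : set 'M[R]_(m, n)) (D : R) (T : nat)
    (l r : nat -> 'M[R]_(m, n) -> R) (x g h : nat -> 'M[R]_(m, n)) (u : 'M[R]_(m, n)) k :
  let S t := Num.sqrt (\sum_(1 <= s < t) spectral_norm (g s - h s) ^+ 2) in
  let B := bregman (Phi 1 (beta R m n)) in
  (0 < m)%N -> (0 < n)%N -> convex_set K ->
  0 < D -> (forall y, K y -> nuclear_norm y <= D) ->
  (forall t, (1 <= t <= T)%N -> (forall y, 0 <= r t y) /\ convex_function setT (r t)) ->
  K (x 1%N) -> K u ->
  (h 1%N = 0 \/ argmins K (fun y => frob_inner (h 1%N) y + r 1%N y) (x 1%N)) ->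
  (forall t, (1 <= t <= T)%N -> subgradients K (l t) (x t) (g t)) ->
  (forall t, (1 <= t < T)%N ->
    argmins K (fun y => frob_inner (g t - h t + h t.+1) y + r t.+1 y
                        + bregman (regulariser D g h t.+1) y (x t))
      (x t.+1)) ->
  (k < T)%N ->
  K (x k.+1) /\
  \sum_(1 <= t < k.+1) (l t (x t) - l t u) + \sum_(1 <= t < k.+2) (r t (x t) - r t u)
    + frob_inner (h k.+1) (x k.+1 - u) + alpha D g h k.+1 * B u (x k.+1)
  <= r 1%N (x 1%N) + (7 * D + 7) * Num.sqrt (log_factor m n D) * S k.+1.
Proof.
move=> S B m0 n0 cK D0 KD hr Kx1 Ku h1 hg hx.
have b0 := beta_gt0 R m0 n0; have db := dim_beta R m0 n0.
have L0 := log_factor_gt0 m0 n0 D0.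
set e := Num.sqrt (log_factor m n D).
have e0 : 0 < e by rewrite sqrtr_gt0.
have alphaE t : alpha D g h t = e^-1 * S t by rewrite /alpha etaE.
have S1 : S 1%N = 0 by rewrite /S big_geq// sqrtr0.
have diam y : K y -> B u y <= (3 * D + 1) * e ^+ 2.
  move=> Ky; rewrite /e sqr_sqrtr; last exact: ltW.
  apply: (bregman_Phi_diameter b0 db (ltW L0)); [|exact: KD|exact: KD].
  exact: ln_dim_le_log_factor.
elim: k => [T0|k IH kT].
  split=> //; rewrite big_geq// big_nat1 add0r alphaE S1 !mulr0 mul0r !addr0.
  have [r0 _] := hr 1%N T0.
  have := r0 u; have := r0 (x 1%N).
  case: h1 => [->|[_ /(_ u Ku)]]; first by rewrite frobC frob0r; lra.
  by rewrite frobBr; lra.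
have [Kx IH'] := IH (ltnW kT); have kT1 : (1 <= k.+1 < T)%N by [].
have step := hx _ kT1; have Kx' : K (x k.+2) by case: step.
split=> //.
have S2 : S k.+2 ^+ 2 = S k.+1 ^+ 2 + spectral_norm (g k.+1 - h k.+1) ^+ 2.
  by rewrite !sqr_sqrtr ?sumr_ge0// 1?big_nat_recr// => i _; rewrite sqr_ge0.
have aS0 t : 0 <= S t by exact: sqrtr_ge0.
have S12 : S k.+1 <= S k.+2 by rewrite -(@ler_pXn2r _ 2)// ?nnegrE// S2 lerDl sqr_ge0.
have [_ cr] : (forall y, 0 <= r k.+2 y) /\ convex_function setT (r k.+2) by exact: hr.
have a0 : 0 <= e^-1 * S k.+2 by rewrite mulr_ge0// invr_ge0 ltW.
rewrite /regulariser alphaE in step.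
have m1 := mirror_step b0 a0 cK cr Ku step.
have hW := op_leN (op_le_spectral_norm (g k.+1 - h k.+1)).
have st := stability b0 db e0 (spectral_norm_ge0 _) (ltW D0) (aS0 k.+1) (aS0 k.+2) S2
  hW (KD _ Kx') (KD _ Kx).
rewrite !(bregman_Phi_scale (e^-1 * S k.+2))// -/B in m1 st.
have sg : l k.+1 (x k.+1) - l k.+1 u <= frob_inner (g k.+1) (x k.+1 - u).
  have := hg k.+1; rewrite /= (ltnW kT) => /(_ isT) /(_ u Ku).
  by rewrite !frobBr; lra.
(* Raising alpha costs its increment times the divergence to [u]. *)
have dm : e^-1 * (S k.+2 - S k.+1) * B u (x k.+1) <= (3 * D + 1) * e * (S k.+2 - S k.+1).
  have -> : (3 * D + 1) * e * (S k.+2 - S k.+1)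
     = e^-1 * (S k.+2 - S k.+1) * ((3 * D + 1) * e ^+ 2) by field; rewrite gt_eqF.
  rewrite ler_wpM2l ?diam// mulr_ge0 ?invr_ge0 ?subr_ge0//; exact: ltW.
rewrite (big_nat_recr k.+1)// (big_nat_recr k.+2)//= alphaE.
rewrite alphaE in IH'.
move: m1 st sg dm IH'.
rewrite !(frobBr, frobDl, frobNl).
set sl := \sum_(_ <= _ < _) _; set sr := \sum_(_ <= _ < _) _.
lra.
Qed.

Theorem theorem4 (R : realType) :
  exists c : nat -> nat -> R -> R,
    constant_bigO c /\
    forall (m n : nat) (K : set 'M[R]_(m, n)) (D : R) (T : nat)
      (l r : nat -> 'M[R]_(m, n) -> R) (x g h : nat -> 'M[R]_(m, n)),
    (0 < m)%N -> (0 < n)%N -> (0 < T)%N ->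
    compact K -> convex_set K ->
    0 < D -> (forall y, K y -> nuclear_norm y <= D) ->
    (forall t, (1 <= t <= T)%N -> convex_function K (l t)) ->
    (forall t, (1 <= t <= T)%N ->
      [/\ forall y, 0 <= r t y,
          convex_function setT (r t) & closed_function (r t)]) ->
    K (x 1%N) ->
    (* start of the protocol: either there is no hint before the first
       decision, or the first decision is the update with no past gradient,
       no past hint and alpha_1 = 0 *)
    (h 1%N = 0 \/ argmins K (fun y => frob_inner (h 1%N) y + r 1%N y) (x 1%N)) ->
    (forall t, (1 <= t <= T)%N -> subgradients K (l t) (x t) (g t)) ->
    (forall t, (1 <= t < T)%N ->
      argmins K (fun y => frob_inner (g t - h t + h t.+1) y + r t.+1 y
                          + bregman (regulariser D g h t.+1) y (x t))
        (x t.+1)) ->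
    regret K (fun t y => l t y + r t y) x T
      <= r 1%N (x 1%N)
         + c m n D * Num.sqrt (\sum_(1 <= t < T.+1) spectral_norm (g t - h t) ^+ 2).
Proof.
exists (@regret_constant R); split; first exact: regret_constant_bigO.
move=> m n K D T l r x g h m0 n0 T0 _ cK D0 KD _ hr Kx1 h1 hg hx.
rewrite /regret lerBlDr -lerBlDl; apply: lb_le_inf.
  by exists (\sum_(1 <= t < T.+1) (l t (x 1%N) + r t (x 1%N))), (x 1%N).
move=> _ [u Ku <-]; rewrite lerBlDl -lerBlDr -sumrB.
case: T T0 hr hg hx => // k _ hr hg hx.
have hr' t : (1 <= t <= k.+1)%N -> (forall y, 0 <= r t y) /\ convex_function setT (r t).
  by move=> /hr[].
have [Kx P] := regret_prefix m0 n0 cK D0 KD hr' Kx1 Ku h1 hg hx (ltnSn k).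
set S := Num.sqrt _.
pose S0 := Num.sqrt (\sum_(1 <= t < k.+1) spectral_norm (g t - h t) ^+ 2).
rewrite -/S0 in P.
(* In the last round the pairing of the gradient error with [x_T - u] is bounded
   by the nuclear norms alone. *)
have lastE : spectral_norm (g k.+1 - h k.+1) ^+ 2 <= S ^+ 2 /\ S0 ^+ 2 <= S ^+ 2.
  rewrite !sqr_sqrtr ?sumr_ge0// => [|i _|i _]; rewrite ?sqr_ge0//.
  by rewrite !(big_nat_recr k.+1)//= lerDl lerDr sqr_ge0 sumr_ge0// => i _; rewrite sqr_ge0.
have [GS S0S] : spectral_norm (g k.+1 - h k.+1) <= S /\ S0 <= S.
  have S_ge0 : 0 <= S by exact: sqrtr_ge0.
  have [gS sS] := lastE.
  split; rewrite -(@ler_pXn2r _ 2)// nnegrE; first exact: spectral_norm_ge0.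
  exact: sqrtr_ge0.
have B0 : 0 <= alpha D g h k.+1 * bregman (Phi 1 (beta R m n)) u (x k.+1).
  rewrite mulr_ge0 ?bregman_Phi_ge0 ?beta_gt0//.
  by rewrite /alpha mulr_ge0 ?sqrtr_ge0.
have sg : l k.+1 (x k.+1) - l k.+1 u <= frob_inner (g k.+1) (x k.+1 - u).
  by have := hg k.+1; rewrite /= leqnn => /(_ isT) /(_ u Ku); rewrite !frobBr; lra.
have lastW : frob_inner (g k.+1 - h k.+1) (x k.+1 - u) <= 2 * D * S.
  have G0 := spectral_norm_ge0 (g k.+1 - h k.+1).
  have hW := op_le_spectral_norm (g k.+1 - h k.+1).
  have := holder_nuclear (x k.+1) G0 hW; have := holder_nuclear u G0 hW.
  have := ler_wpM2l G0 (KD _ Kx); have := ler_wpM2l G0 (KD _ Ku).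
  have := ler_wpM2r (ltW D0) GS.
  by rewrite frobBr !ler_norml => h2 h3 h4 /andP[? ?] /andP[? ?]; lra.
have c0 : 0 <= (7 * D + 7) * Num.sqrt (log_factor m n D).
  by rewrite mulr_ge0 ?sqrtr_ge0//; lra.
have := ler_wpM2l c0 S0S.
have -> : \sum_(1 <= t < k.+2) (l t (x t) + r t (x t) - (l t u + r t u))
    = \sum_(1 <= t < k.+1) (l t (x t) - l t u) + (l k.+1 (x k.+1) - l k.+1 u)
      + \sum_(1 <= t < k.+2) (r t (x t) - r t u).
  rewrite -[X in X + _](big_nat_recr k.+1)//= -big_split; apply: eq_bigr => t _ /=.
  by ring.
move: P B0 sg lastW; rewrite /regret_constant frobBl.
by lra.
Qed.
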